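(* Let $G=(\mathrm{GL}\times\mathrm{GL})^+_{\mathbb C|\mathbb R}(1|1)$ and $K=\mathrm{UGL}^+_{\mathbb R}(1|1)$. For a suitable normalisation of the $K$-invariant Berezinian density on $K/M$, we have for every $\lambda\in\mathfrak a^*$, every cs manifold $T$, and every $T$-valued point $h$ of $\mathbb A(\mathfrak a_{\mathbb R})$ $$\phi_\lambda(e^h)=-\lambda(h^+)\,e^{\lambda(h)}\sinh\alpha(h).$$
   Context: A cs manifold is a locally super-ringed space over $\mathbb C$ locally isomorphic to $(\mathbb R^p,\mathcal C^\infty_{\mathbb R^p}\otimes\bigwedge(\mathbb C^q)^* )$ (complex-valued smooth functions). A cs Lie supergroup is a group object in cs manifolds, determined by a supergroup pair $(\mathfrak g,G_0)$ (complex Lie superalgebra, and real Lie group whose Lie algebra $\mathfrak g_{\bar0,\mathbb R}$ is a real form of $\mathfrak g_{\bar0}$). Here $\mathfrak g=\mathfrak{gl}(1|1,\mathbb C)\times\mathfrak{gl}(1|1,\mathbb C)$ and $G_0=\{(\mathrm{diag}(z,r),\mathrm{diag}(\bar z^{-1},s)):z\in\mathbb C^\times,r,s>0\}$; $\theta(x,y)=(y,x)$; $\mathfrak k=\{(x,x)\}$, $\mathfrak p=\{(x,-x)\}$; $K$ is given by $\mathfrak k$ and $K_0=\{(\mathrm{diag}(z,r),\mathrm{diag}(z,r)):|z|=1,r>0\}$. The even Cartan subspace is $\mathfrak a=\mathfrak p_{\bar0}$ with basis $h_1=(\mathrm{diag}(1,0),-\mathrm{diag}(1,0))$, $h_2=(\mathrm{diag}(0,1),-\mathrm{diag}(0,1))$;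 $h^+=h_1+h_2$; $\mathfrak a_{\mathbb R}=\mathbb Rh_1\oplus\mathbb Rh_2$. The restricted roots are $\pm\alpha$, $\alpha(a_1h_1+a_2h_2)=a_1-a_2$; the positive system is $\{\alpha\}$, the multiplicity is $m_\alpha=-2$, and $\varrho=-\alpha$. $A$ and $N$ are the connected subsupergroups with Lie superalgebras $\mathfrak a$ and $\mathfrak n=\mathfrak g^\alpha$; $M$ is the closed subsupergroup of $K$ with Lie superalgebra $\mathfrak z_{\mathfrak k}(\mathfrak a)=\mathfrak k_{\bar0}$ and $M_0=Z_{K_0}(\mathfrak a)=K_0$. The Iwasawa decomposition $K\times A\times N\cong G$ holds; $H:G\to\mathbb A(\mathfrak a_{\mathbb R})$ is given by $g=k(g)e^{H(g)}n(g)$ on $T$-valued points. $|D\dot k|$ is a nonzero $K$-invariant Berezinian density on $K/M$ (unique up to a constant), and the spherical superfunction is $\phi_\lambda(g)=\int_{K/M}|D\dot k|\,e^{(\lambda-\varrho)(H(gk))}$. *)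

(* Defs.v *)
From HB Require Import structures.
From mathcomp Require Import all_boot all_order all_algebra.
From mathcomp Require Export complex.
From mathcomp Require Import all_classical all_reals all_analysis.

Set Implicit Arguments.
Unset Strict Implicit.
Unset Printing Implicit Defensive.

Import Order.TTheory GRing.Theory Num.Theory numFieldNormedType.Exports.

Local Open Scope classical_set_scope.
Local Open Scope ring_scope.
Local Open Scope complex_scope.

(** * Supercommutative superalgebras over the complex numbers *)

(* A complex superalgebra is a ring A with a ring morphism [scal] from the
   complex numbers to its centre and a Z/2-grading.  The grading is encoded by
   its parity involution, equal to 1 on the even part and to -1 on the odd
   part; since 2 is invertible, the eigenspaces of the involution recover the
   grading.  The zero algebra is allowed, being the algebra of sections over
   the empty set. *)
HB.mixin Record isSuperAlg (R : realType) A of GRing.PzRing A := {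
  scal : R[i] -> A;
  scalD : forall c d : R[i], scal (c + d) = scal c + scal d;
  scalM : forall c d : R[i], scal (c * d) = scal c * scal d;
  scal1 : scal 1 = 1;
  scalC : forall (c : R[i]) (x : A), scal c * x = x * scal c;
  parity : A -> A;
  parityD : forall x y : A, parity (x + y) = parity x + parity y;
  parityM : forall x y : A, parity (x * y) = parity x * parity y;
  parityK : forall x : A, parity (parity x) = x;
  parity_scal : forall c : R[i], parity (scal c) = scal c;
  even_central : forall x y : A, parity x = x -> x * y = y * x;
  odd_anticomm : forall x y : A,
    parity x = - x -> parity y = - y -> x * y = - (y * x)
}.

#[short(type="superAlgType")]
HB.structure Definition SuperAlg (R : realType) :=
  {A of GRing.PzRing A & isSuperAlg R A}.

Section SuperAlgTheory.
Variables (R : realType) (A : superAlgType R).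
Implicit Types x y : A.

Definition is_even x := parity x = x.
Definition is_odd x := parity x = - x.

(* invertibility in the possibly trivial ring [A] *)
Definition is_unit x := exists y, x * y = 1 /\ y * x = 1.

Lemma parity0 : parity (0 : A) = 0.
Proof. by apply: (addrI (parity 0)); rewrite -parityD !addr0. Qed.

Lemma parityN x : parity (- x) = - parity x.
Proof. by apply: (addrI (parity x)); rewrite -parityD !subrr parity0. Qed.

Lemma parity1 : parity (1 : A) = 1.
Proof. by rewrite -(scal1 (s := A)) parity_scal. Qed.

Lemma scal0 : scal 0 = 0 :> A.
Proof. by apply: (addrI (scal 0)); rewrite -scalD !addr0. Qed.

Lemma scalN (c : R[i]) : scal (- c) = - scal c :> A.
Proof. by apply: (addrI (scal c)); rewrite -scalD !subrr scal0. Qed.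

Lemma double_inj x y : x + x = y + y -> x = y.
Proof.
have h2 : (1 + 1 : R[i]) != 0 by rewrite -[1 + 1]/(2%:R) pnatr_eq0.
have twice z : scal (1 + 1) * z = z + z :> A.
  by rewrite scalD !scal1 mulrDl !mul1r.
move=> e; rewrite -[x]mul1r -[y]mul1r -(scal1 (s := A)) -(mulVf h2) scalM.
by rewrite -!mulrA !twice e.
Qed.

Lemma odd_mulr x y : is_odd x -> x * parity y = y * x.
Proof.
move=> ox.
have ev : parity (y + parity y) = y + parity y by rewrite parityD parityK addrC.
have od : parity (y - parity y) = - (y - parity y).
  by rewrite parityD parityN parityK opprB.
have h1 := even_central _ x ev; have h3 := odd_anticomm _ _ ox od.
apply: double_inj.
have -> : x * parity y + x * parity y
    = x * (y + parity y) - x * (y - parity y).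
  by rewrite !mulrDr mulrN opprD opprK addrACA subrr add0r.
by rewrite -h1 h3 opprK -mulrDl addrACA subrr addr0 mulrDl.
Qed.

End SuperAlgTheory.

Definition superalg_hom (R : realType) (A B : superAlgType R) (f : A -> B) :=
  [/\ {morph f : x y / x + y},
      {morph f : x y / x * y},
      {morph f : x / parity x} &
      forall c : R[i], f (scal c) = scal c].

Section ComplexSuperAlg.
Variable R : realType.

Let complex_odd (x y : R[i]) : x = - x -> y = - y -> x * y = - (y * x).
Proof.
move=> xN _; suff -> : x = 0 by rewrite mul0r mulr0 oppr0.
have : x *+ 2 == 0 by rewrite mulr2n {1}xN addNr.
by rewrite mulrn_eq0 /= => /eqP.
Qed.

HB.instance Definition _ := isSuperAlg.Build R R[i]
  (scal := id) (parity := id)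
  (fun _ _ => erefl) (fun _ _ => erefl) erefl (@mulrC _)
  (fun _ _ => erefl) (fun _ _ => erefl) (fun _ => erefl) (fun _ => erefl)
  (fun x y _ => mulrC x y) complex_odd.

End ComplexSuperAlg.

(* A[xi], one odd variable xi being adjoined: the pair (f0, f1) stands for
   f0 + f1 xi. *)
Definition adjoin (A : Type) : Type := (A * A)%type.

Section Adjoin.
Variables (R : realType) (A : superAlgType R).

HB.instance Definition _ := GRing.Zmodule.copy (adjoin A) (A * A)%type.

Implicit Types f g h : adjoin A.

Definition adjoin_mul f g : adjoin A :=
  (f.1 * g.1, f.1 * g.2 + f.2 * parity g.1).
Definition adjoin_parity f : adjoin A := (parity f.1, - parity f.2).
Definition adjoin_emb (f : A) : adjoin A := (f, 0).
Definition adjoin_var : adjoin A := (0, 1).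

Let mulA : associative adjoin_mul.
Proof.
move=> f g h; congr pair; rewrite /= ?mulrA // parityM !mulrDr mulrDl !mulrA.
by rewrite addrA.
Qed.
Let mul1 : left_id (1, 0) adjoin_mul.
Proof. by case=> f0 f1; rewrite /adjoin_mul /= !mul1r mul0r addr0. Qed.
Let mulr_1 : right_id (1, 0) adjoin_mul.
Proof. by case=> f0 f1; rewrite /adjoin_mul /= parity1 !mulr1 mulr0 add0r. Qed.
Let mulDl : left_distributive adjoin_mul +%R.
Proof. by move=> f g h; congr pair; rewrite /= ?mulrDl // addrACA. Qed.
Let mulDr : right_distributive adjoin_mul +%R.
Proof. by move=> f g h; congr pair; rewrite /= ?parityD !mulrDr // addrACA. Qed.

HB.instance Definition _ :=
  GRing.Zmodule_isPzRing.Build (adjoin A) mulA mul1 mulr_1 mulDl mulDr.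

Let scal_D (c d : R[i]) :
  adjoin_emb (scal (c + d)) = adjoin_emb (scal c) + adjoin_emb (scal d).
Proof. by congr pair; rewrite /= ?scalD ?addr0. Qed.
Let scal_M (c d : R[i]) :
  adjoin_emb (scal (c * d)) = adjoin_emb (scal c) * adjoin_emb (scal d).
Proof. by congr pair; rewrite /= ?scalM ?mulr0 ?mul0r ?addr0. Qed.
Let scal_1 : adjoin_emb (scal 1) = 1.
Proof. by congr pair; rewrite scal1. Qed.
Let scal_C (c : R[i]) f : adjoin_emb (scal c) * f = f * adjoin_emb (scal c).
Proof.
congr pair; rewrite /= ?scalC //.
by rewrite parity_scal mul0r mulr0 addr0 add0r.
Qed.
Let parity_D f g :
  adjoin_parity (f + g) = adjoin_parity f + adjoin_parity g.
Proof. by congr pair; rewrite /= parityD // opprD. Qed.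
Let parity_M f g :
  adjoin_parity (f * g) = adjoin_parity f * adjoin_parity g.
Proof.
by congr pair; rewrite /= ?parityD !parityM // opprD mulrN mulNr.
Qed.
Let parity_K f : adjoin_parity (adjoin_parity f) = f.
Proof. by case: f => f0 f1; rewrite /adjoin_parity /= parityN !parityK opprK. Qed.
Let parity_s (c : R[i]) :
  adjoin_parity (adjoin_emb (scal c)) = adjoin_emb (scal c).
Proof. by congr pair; rewrite /= ?parity_scal // parity0 oppr0. Qed.
Let even_c f g : adjoin_parity f = f -> f * g = g * f.
Proof.
case: f g => f0 f1 [g0 g1] [ef0 of1].
have o1 : is_odd f1 by rewrite /is_odd -[in RHS]of1 opprK.
congr pair; rewrite /=; first exact: even_central.
by rewrite (even_central _ _ ef0) (odd_mulr _ o1) ef0 addrC.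
Qed.
Let odd_a f g :
  adjoin_parity f = - f -> adjoin_parity g = - g -> f * g = - (g * f).
Proof.
case: f g => f0 f1 [g0 g1] [of0 /oppr_inj ef1] [og0 /oppr_inj eg1].
congr pair; rewrite /=; first exact: odd_anticomm.
rewrite og0 of0 !mulrN (even_central _ _ ef1) (even_central _ _ eg1).
by rewrite opprD opprK addrC.
Qed.

HB.instance Definition _ := isSuperAlg.Build R (adjoin A)
  scal_D scal_M scal_1 scal_C parity_D parity_M parity_K parity_s even_c odd_a.

End Adjoin.

(** * Super-ringed spaces *)

Record opens (X : topologicalType) := Opens {
  oset :> set X;
  oset_open : open oset
}.

Definition full (X : topologicalType) : opens X := Opens openT.

Definition opens_preimage (X Y : topologicalType) (f : X -> Y)
  (fc : continuous f) (V : opens Y) : opens X :=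
  Opens (open_comp (fun x _ => fc x) (oset_open V)).

Record superspace (R : realType) := SuperSpace {
  spt :> topologicalType;
  sec : opens spt -> superAlgType R;
  res : forall U V : opens spt, V `<=` U -> sec U -> sec V;
  res_hom : forall (U V : opens spt) (VU : V `<=` U), superalg_hom (res VU);
  res_id : forall (U : opens spt) (UU : U `<=` U) (f : sec U), res UU f = f;
  res_comp : forall (U V W : opens spt)
    (VU : V `<=` U) (WV : W `<=` V) (WU : W `<=` U) (f : sec U),
    res WV (res VU f) = res WU f;
  sheaf_sep : forall (I : Type) (U : opens spt) (V : I -> opens spt)
    (VU : forall i, V i `<=` U),
    (forall x, oset U x -> exists i, oset (V i) x) ->
    forall f g : sec U, (forall i, res (VU i) f = res (VU i) g) -> f = g;
  sheaf_glue : forall (I : Type) (U : opens spt) (V : I -> opens spt)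
    (VU : forall i, V i `<=` U),
    (forall x, oset U x -> exists i, oset (V i) x) ->
    forall s : (forall i, sec (V i)),
    (forall i j (W : opens spt) (Wi : W `<=` V i) (Wj : W `<=` V j),
       res Wi (s i) = res Wj (s j)) ->
    exists f : sec U, forall i, res (VU i) f = s i
}.

Notation global X := (sec (full X)).

(* [has_value f x c]: the value f(x), i.e. the class of the germ of f modulo
   the maximal ideal of the stalk at x, is c. *)
Definition has_value (R : realType) (X : superspace R) (f : global X) (x : X)
    (c : R[i]) :=
  forall (V : opens X) (VT : V `<=` full X), oset V x ->
    ~ is_unit (res VT (f - scal c)).

Record morphism (R : realType) (X Y : superspace R) := Morphism {
  mfun :> X -> Y;
  mfun_cont : continuous mfun;
  pull : forall V : opens Y, sec V -> sec (opens_preimage mfun_cont V);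
  pull_hom : forall V, superalg_hom (@pull V);
  pull_res : forall (V W : opens Y) (WV : W `<=` V)
    (WV' : opens_preimage mfun_cont W `<=` opens_preimage mfun_cont V)
    (f : sec V), pull (res WV f) = res WV' (pull f);
  pull_local : forall (V : opens Y) (f : sec V) (x : X),
    (exists (W : opens X) (WV : W `<=` opens_preimage mfun_cont V),
       oset W x /\ is_unit (res WV (pull f))) ->
    (exists (W : opens Y) (WV : W `<=` V),
       oset W (mfun x) /\ is_unit (res WV f))
}.

Arguments mfun_cont {R X Y} m _ _ _.
Arguments pull {R X Y} m V _.

Definition pull_global (R : realType) (X Y : superspace R)
    (h : morphism X Y) (f : global Y) : global X :=
  @res _ X (opens_preimage (mfun_cont h) (full Y)) (full X)
    (fun _ _ => I) (pull h (full Y) f).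

Definition isomorphic (R : realType) (X Y : superspace R) :=
  exists f : morphism X Y,
    (exists g : Y -> X, [/\ continuous g, cancel f g & cancel g f]) /\
    (forall V : opens Y, bijective (pull f V)).

Section OpenSubspace.
Variables (R : realType) (X : superspace R) (U : opens X).

Let pt : topologicalType := set_type U.

Lemma open_image (W : opens pt) : open (set_val @` W : set X).
Proof.
case: W => W oW; have [A oA WE] := oW; rewrite /= -WE.
rewrite (_ : _ @` _ = A `&` U); first by apply: openI => //; exact: oset_open.
apply/seteqP; split=> [_ [x Ax <-]|x [Ax Ux]].
  by split=> //; exact: set_mem (valP x).
by exists (exist _ x (mem_set Ux)).
Qed.

Definition opens_image (W : opens pt) : opens X := Opens (open_image W).

Lemma opens_imageS (V W : opens pt) : W `<=` V -> opens_image W `<=` opens_image V.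
Proof. by move=> WV; exact: image_subset. Qed.

Program Definition open_subspace : superspace R := {|
  spt := pt;
  sec := fun W => sec (opens_image W);
  res := fun V W (WV : W `<=` V) => res (opens_imageS WV)
|}.
Next Obligation. by move=> *; exact: res_hom. Qed.
Next Obligation. by move=> *; exact: res_id. Qed.
Next Obligation. by move=> *; exact: res_comp. Qed.
Next Obligation.
move=> J V W WV cov f g fg.
apply: (@sheaf_sep _ X J (opens_image V) (fun i => opens_image (W i))
  (fun i => opens_imageS (WV i)) _ f g fg) => _ [y Vy <-].
by have [i Wy] := cov _ Vy; exists i, y.
Qed.
Next Obligation.
move=> J V W WV cov s sc.
apply: (@sheaf_glue _ X J (opens_image V) (fun i => opens_image (W i))
  (fun i => opens_imageS (WV i)) _ s) => [_ [y Vy <-]|i j Z Zi Zj].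
  by have [i Wy] := cov _ Vy; exists i, y.
have oZ' : open ((set_val : pt -> X) @^-1` Z) by exists Z => //; exact: oset_open.
pose Z' : opens pt := Opens oZ'.
have Z'S k : Z `<=` opens_image (W k) -> Z' `<=` W k.
  move=> Zk y Zy; have [z Wz zy] := Zk _ Zy.
  by rewrite (_ : y = z) //; apply: val_inj.
have ZZ' : Z `<=` opens_image Z'.
  by move=> z Zz; have [y Wy yz] := Zi _ Zz; exists y => //=; rewrite /= yz.
have := sc i j Z' (Z'S _ Zi) (Z'S _ Zj).
move=> /(congr1 (res ZZ')).
by rewrite !(res_comp _ _ Zi) !(res_comp _ _ Zj).
Qed.

End OpenSubspace.

(* The product of X with the affine superspace A^{0|1}. *)
Section OddLine.
Variables (R : realType) (X : superspace R).

Definition adjoin_res (U V : opens X) (VU : V `<=` U)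
  (f : adjoin (sec U)) : adjoin (sec V) := (res VU f.1, res VU f.2).

Program Definition odd_line : superspace R := {|
  spt := X;
  sec := fun U => adjoin (sec U) : superAlgType R;
  res := adjoin_res
|}.
Next Obligation.
move=> U V VU; have [a m p s] := res_hom VU.
have z : res VU 0 = 0 by apply: (addrI (res VU 0)); rewrite -a !addr0.
have n x : res VU (- x) = - res VU x.
  by apply: (addrI (res VU x)); rewrite -a !subrr.
split=> [x y|x y|x|c]; congr pair; rewrite /= ?a ?n ?m ?s ?z //.
- by rewrite p.
- by rewrite p.
Qed.
Next Obligation. by move=> U UU [f g]; congr pair; exact: res_id. Qed.
Next Obligation. by move=> *; congr pair; exact: res_comp. Qed.
Next Obligation.
move=> J U V VU cov [f0 f1] [g0 g1] fg.
have [e0 e1] : f0 = g0 /\ f1 = g1.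
  by split; apply: (@sheaf_sep _ X J U V VU cov) => i; case: (fg i).
by rewrite e0 e1.
Qed.
Next Obligation.
move=> J U V VU cov s sc.
have [|f0 h0] := @sheaf_glue _ X J U V VU cov (fun i => (s i).1).
  by move=> i j W Wi Wj; case: (sc i j W Wi Wj).
have [|f1 h1] := @sheaf_glue _ X J U V VU cov (fun i => (s i).2).
  by move=> i j W Wi Wj; case: (sc i j W Wi Wj).
by exists (f0, f1) => i; rewrite /adjoin_res /= h0 h1; case: (s i).
Qed.

End OddLine.

(** * The spaces of smooth complex-valued functions *)

Section Smooth.
Variables (R : realType) (p : nat).
Implicit Types (U : set 'rV[R]_p) (f g : 'rV[R]_p -> R).

Definition partial (j : 'I_p) f : 'rV[R]_p -> R :=
  fun x => 'D_(delta_mx 0 j : 'rV[R]_p) f x.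

Fixpoint Ck (k : nat) U f : Prop :=
  (forall x, U x -> {for x, continuous f}) /\
  if k is k'.+1 then forall j : 'I_p,
    (forall x, U x -> derivable f x (delta_mx 0 j)) /\ Ck k' U (partial j f)
  else True.

Definition smooth U (f : 'rV[R]_p -> R[i]) :=
  forall k, Ck k U (fun x => complex.Re (f x)) /\ Ck k U (fun x => complex.Im (f x)).

Lemma Ck_cont k U f : Ck k U f -> forall x, U x -> {for x, continuous f}.
Proof. by case: k => [|k] []. Qed.

Lemma Ck_S k U f : Ck k.+1 U f -> Ck k U f.
Proof.
elim: k f => [|k IH] f [cf df]; first by split.
by split=> // j; have [dj /IH cj] := df j.
Qed.

Lemma Ck_eq k U f g : open U -> (forall x, U x -> f x = g x) ->
  Ck k U f -> Ck k U g.
Proof.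
move=> oU; elim: k f g => [|k IH] f g fg [cf df].
  split=> // x Ux.
  have nfg : \forall y \near x, f y = g y.
    by apply: filterS (open_nbhs_nbhs (conj oU Ux)) => y /fg.
  rewrite /prop_for /continuous_at -(fg _ Ux).
  exact: cvg_trans (near_eq_cvg nfg) (cf x Ux).
have nfg x : U x -> \forall y \near x, f y = g y.
  by move=> Ux; apply: filterS (open_nbhs_nbhs (conj oU Ux)) => y /fg.
split=> [x Ux|j].
  rewrite /prop_for /continuous_at -(fg _ Ux).
  exact: cvg_trans (near_eq_cvg (nfg x Ux)) (cf x Ux).
have [dj cj] := df j; split=> [x Ux|].
  by apply: near_eq_derivable (dj x Ux); exact: nfg.
apply: IH cj => x Ux; apply: near_eq_derive; exact: nfg.
Qed.

Lemma Ck_local k U f :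
  (forall x, U x -> exists V, [/\ open V, V x & Ck k V f]) -> Ck k U f.
Proof.
elim: k f => [|k IH] f loc; split=> //.
- by move=> x /loc[V [_ Vx [cf _]]]; exact: cf.
- by move=> x /loc[V [_ Vx [cf _]]]; exact: cf.
move=> j; split=> [x /loc[V [_ Vx [_ /(_ j)[df _]]]]|]; first exact: df.
by apply: IH => x /loc[V [oV Vx [_ /(_ j)[_ Cj]]]]; exists V.
Qed.

Lemma Ck_sub k U V f : V `<=` U -> Ck k U f -> Ck k V f.
Proof.
move=> VU; elim: k f => [|k IH] f [cf df]; split=> //.
- by move=> x /VU; exact: cf.
- by move=> x /VU; exact: cf.
by move=> j; have [dj cj] := df j; split; [move=> x /VU; exact: dj|exact: IH].
Qed.

Lemma Ck_cst k U (c : R) : Ck k U (fun=> c).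
Proof.
elim: k c => [|k IH] c; split=> //; try by move=> x _; exact: cst_continuous.
move=> j; split=> [x _|]; first exact: derivable_cst.
rewrite (_ : partial j _ = fun=> 0) //.
by apply/funext => x; exact: derive_cst.
Qed.

Lemma Ck_add k U f g : open U -> Ck k U f -> Ck k U g ->
  Ck k U (fun x => f x + g x).
Proof.
move=> oU; elim: k f g => [|k IH] f g [cf df] [cg dg]; split=> //.
- by move=> x Ux; exact: (cvgD (cf x Ux) (cg x Ux)).
- by move=> x Ux; exact: (cvgD (cf x Ux) (cg x Ux)).
move=> j; have [dfj cfj] := df j; have [dgj cgj] := dg j; split.
  by move=> x Ux; apply: derivableD; [exact: dfj|exact: dgj].
apply: Ck_eq oU _ (IH _ _ cfj cgj) => x Ux.
by rewrite /partial -deriveD; [|exact: dfj|exact: dgj].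
Qed.

Lemma Ck_mul k U f g : open U -> Ck k U f -> Ck k U g ->
  Ck k U (fun x => f x * g x).
Proof.
move=> oU; elim: k f g => [|k IH] f g Cf Cg.
  split=> // x Ux; exact: (cvgM (Ck_cont Cf Ux) (Ck_cont Cg Ux)).
split=> [x Ux|j].
  exact: (cvgM (Ck_cont Cf Ux) (Ck_cont Cg Ux)).
have [dfj cfj] := Cf.2 j; have [dgj cgj] := Cg.2 j; split.
  by move=> x Ux; apply: derivableM; [exact: dfj|exact: dgj].
apply: Ck_eq oU _
  (Ck_add oU (IH _ _ (Ck_S Cf) cgj) (IH _ _ (Ck_S Cg) cfj)) => x Ux.
by rewrite /partial [RHS]deriveM; [|exact: dfj|exact: dgj].
Qed.

Lemma Ck_opp k U f : open U -> Ck k U f -> Ck k U (fun x => - f x).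
Proof.
move=> oU Cf; apply: Ck_eq oU _ (Ck_mul oU (Ck_cst k U (-1)) Cf) => x _.
by rewrite mulN1r.
Qed.

Lemma Ck_comp k U g (P : (R -> R) -> Prop) (F : R -> R) : open U ->
  (forall F, P F -> exists2 F', P F' & forall t : R, is_derive t 1 F (F' t)) ->
  P F -> Ck k U g -> Ck k U (fun x => F (g x)).
Proof.
move=> oU PP; elim: k F => [|k IH] F PF Cg; have [F' PF' dF] := PP F PF;
  have contF t : {for t, continuous F} by
    have [dFt _] := dF t;
    exact: (differentiable_continuous ((derivable1_diffP _ _).1 dFt)).
  split=> // x Ux; apply: (continuous_comp (Ck_cont Cg Ux)).
  exact: contF.
have D x j : U x -> is_derive x (delta_mx 0 j : 'rV[R]_p)
    (fun x => F (g x)) (F' (g x) * partial j g x).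
  move=> Ux; pose v : 'rV[R]_p := delta_mx 0 j.
  pose G (t : R) := g (t *: v + x).
  have DE (H : 'rV[R]_p -> R) : 'D_1 (fun t : R => H (t *: v + x)) 0 = 'D_v H x.
    rewrite /derive.
    set a := fun _ => _; set b := fun _ => _; suff -> : a = b by [].
    apply/funext => t; rewrite /a /b /=.
    by rewrite addr0 scale0r add0r /GRing.scale /= mulr1.
  have dG : is_derive (0 : R) 1 G (partial j g x).
    rewrite /partial -(DE g); apply: derivableP.
    by apply: (derivable1P g x v).1; have [dg _] := Cg.2 j; exact: dg.
  have dFG : is_derive (0 : R) 1 (F \o G) (F' (g x) * partial j g x).
    have <- : G 0 = g x by rewrite /G scale0r add0r.
    have dF' : is_derive (G 0) 1 F (F' (G 0)) by exact: dF.
    exact: (is_derive1_comp dF' dG).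
  have dd : derivable (fun x => F (g x)) x v.
    by apply: (derivable1P (fun x => F (g x)) x v).2; case: dFG.
  by split=> //; case: dFG => _ <-; rewrite -(DE (fun x => F (g x))).
split=> [x Ux|j].
  apply: (continuous_comp (Ck_cont Cg Ux)).
  exact: contF.
split=> [x /(D x j)[]//|].
apply: Ck_eq oU _ (Ck_mul oU (IH _ PF' (Ck_S Cg)) (Cg.2 j).2) => x Ux.
by case: (D x j Ux).
Qed.

Lemma Ck_exp k U g : open U -> Ck k U g -> Ck k U (fun x => expR (g x)).
Proof.
move=> oU; apply: (@Ck_comp _ _ _ (fun F => F = expR)) => // F ->.
by exists expR => // t; exact: is_derive_expR.
Qed.

Let trig (a b : R) (t : R) := a * cos t + b * sin t.

Lemma Ck_trig k U g a b : open U -> Ck k U g -> Ck k U (fun x => trig a b (g x)).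
Proof.
move=> oU; apply: (@Ck_comp _ _ _ (fun F => exists c d, F = trig c d)) => //.
  move=> F [c [d ->]]; exists (trig d (- c)); first by exists d, (- c).
  move=> t; apply: (is_derive_eq (is_deriveD
    (is_deriveZ c (is_derive_cos t)) (is_deriveZ d (is_derive_sin t)))).
  by rewrite /trig /GRing.scale /= mulrN mulNr addrC.
by exists a, b.
Qed.

Lemma Ck_coord k U j : Ck k U (fun x => x 0 j).
Proof.
have D (x v : 'rV[R]_p) : is_derive x v (fun x : 'rV[R]_p => x 0 j) (v 0 j).
  have Q : (fun h : R => h^-1 *: (((fun x : 'rV[R]_p => x 0 j) \o shift x) (h *: v)
      - x 0 j)) @ 0^' --> v 0 j.
    apply: cvg_near_cst; near=> h.
    rewrite /= !mxE addrK /GRing.scale /= mulrA mulVf ?mul1r //.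
    by near: h; exact: nbhs_dnbhs_neq.
  by split; [apply/cvg_ex; exists (v 0 j)|exact: cvg_lim Q].
case: k => [|k]; split=> //; try by move=> x _; exact: coord_continuous.
move=> i; split=> [x _|]; first by case: (D x (delta_mx 0 i)).
rewrite (_ : partial i _ = fun=> (delta_mx 0 i : 'rV[R]_p) 0 j); first exact: Ck_cst.
by apply/funext => x; case: (D x (delta_mx 0 i)).
Unshelve. all: by end_near. Qed.
Lemma ReD (x y : R[i]) : complex.Re (x + y) = complex.Re x + complex.Re y.
Proof. by case: x y => a b []. Qed.
Lemma ImD (x y : R[i]) : complex.Im (x + y) = complex.Im x + complex.Im y.
Proof. by case: x y => a b []. Qed.
Lemma ReM (x y : R[i]) : complex.Re (x * y) = complex.Re x * complex.Re y - complex.Im x * complex.Im y.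
Proof. by case: x y => a b []. Qed.
Lemma ImM (x y : R[i]) : complex.Im (x * y) = complex.Re x * complex.Im y + complex.Im x * complex.Re y.
Proof. by case: x y => a b []. Qed.

Lemma smooth_cst U (c : R[i]) : smooth U (fun=> c).
Proof. by move=> k; split; exact: Ck_cst. Qed.

Lemma smooth_add U (f g : 'rV[R]_p -> R[i]) : open U ->
  smooth U f -> smooth U g -> smooth U (fun x => f x + g x).
Proof.
move=> oU sf sg k; have [rf mf] := sf k; have [rg mg] := sg k; split.
  by apply: Ck_eq oU _ (Ck_add oU rf rg) => x _; rewrite ReD.
by apply: Ck_eq oU _ (Ck_add oU mf mg) => x _; rewrite ImD.
Qed.

Lemma smooth_mul U (f g : 'rV[R]_p -> R[i]) : open U ->
  smooth U f -> smooth U g -> smooth U (fun x => f x * g x).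
Proof.
move=> oU sf sg k; have [rf mf] := sf k; have [rg mg] := sg k; split.
  apply: Ck_eq oU _ (Ck_add oU (Ck_mul oU rf rg)
    (Ck_opp oU (Ck_mul oU mf mg))) => x _; by rewrite ReM.
apply: Ck_eq oU _ (Ck_add oU (Ck_mul oU rf mg) (Ck_mul oU mf rg)) => x _.
by rewrite ImM.
Qed.

Lemma smooth_eq U (f g : 'rV[R]_p -> R[i]) : open U ->
  (forall x, U x -> f x = g x) -> smooth U f -> smooth U g.
Proof.
move=> oU fg sf k; have [rf mf] := sf k.
by split; [apply: Ck_eq oU _ rf|apply: Ck_eq oU _ mf] => x /fg ->.
Qed.

Lemma smooth_sub U V (f : 'rV[R]_p -> R[i]) :
  V `<=` U -> smooth U f -> smooth V f.
Proof. by move=> VU sf k; have [? ?] := sf k; split; exact: Ck_sub VU _. Qed.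

Lemma smooth_local U (f : 'rV[R]_p -> R[i]) :
  (forall x, U x -> exists V, [/\ open V, V x & smooth V f]) -> smooth U f.
Proof.
move=> loc k; split; apply: Ck_local => x /loc[V [oV Vx sf]]; exists V;
  by split=> //; have [] := sf k.
Qed.

Definition complexify (x : 'rV[R]_p) : 'rV[R[i]]_p := map_mx (fun t => t%:C) x.

Definition cexp (z : R[i]) : R[i] :=
  (expR (complex.Re z) * cos (complex.Im z))
    +i* (expR (complex.Re z) * sin (complex.Im z)).

Lemma smooth_linear (mu : {scalar 'rV[R[i]]_p}) U : open U ->
  smooth U (fun x => mu (complexify x)).
Proof.
move=> oU; have E x : mu (complexify x)
    = \sum_j (x 0 j)%:C * mu (delta_mx 0 j).
  rewrite {1}(row_sum_delta (complexify x)) linear_sum.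
  by apply: eq_bigr => j _; rewrite linearZ /= mxE.
have S (r : seq 'I_p) :
    smooth U (fun x => \sum_(j <- r) (x 0 j)%:C * mu (delta_mx 0 j)).
  elim: r => [|j r IH].
    by apply: (smooth_eq oU) (smooth_cst U 0) => x _; rewrite big_nil.
  apply: (smooth_eq oU) (smooth_add oU (smooth_mul oU _ (smooth_cst U _)) IH).
    by move=> x _; rewrite big_cons.
  by move=> k; split; [exact: Ck_coord|exact: Ck_cst].
by apply: (smooth_eq oU) (S (index_enum _)) => x _.
Qed.

Lemma smooth_cexp (f : 'rV[R]_p -> R[i]) U : open U ->
  smooth U f -> smooth U (fun x => cexp (f x)).
Proof.
move=> oU sf k; have [rf mf] := sf k; split.
  apply: Ck_eq oU _ (Ck_mul oU (Ck_exp oU rf) (Ck_trig 1 0 oU mf)) => x _.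
  by rewrite /trig mul1r mul0r addr0.
apply: Ck_eq oU _ (Ck_mul oU (Ck_exp oU rf) (Ck_trig 0 1 oU mf)) => x _.
by rewrite /trig mul1r mul0r add0r.
Qed.

End Smooth.

(* Smooth complex functions on an open set U of R^p, extended by zero. *)
Section SmoothSections.
Variables (R : realType) (p : nat).

Record smooth_fun (U : opens 'rV[R]_p) := SmoothFun {
  smooth_val :> 'rV[R]_p -> R[i];
  smooth_valP : smooth U smooth_val;
  smooth_val_out : forall x, ~ oset U x -> smooth_val x = 0
}.

HB.instance Definition _ U := gen_eqMixin (smooth_fun U).
HB.instance Definition _ U := gen_choiceMixin (smooth_fun U).

Lemma smooth_fun_ext U (f g : smooth_fun U) :
  (forall x, oset U x -> f x = g x) -> f = g.
Proof.
case: f g => f sf of_ [g sg og] /= fg.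
have E : f = g.
  apply/funext => x; case: (pselect (oset U x)) => Ux; first exact: fg.
  by rewrite of_ // og.
by subst g; congr SmoothFun; exact: Prop_irrelevance.
Qed.

Definition cutoff (U : opens 'rV[R]_p) (f : 'rV[R]_p -> R[i]) :=
  fun x => if `[< oset U x >] then f x else 0.

Lemma cutoff_smooth (U : opens 'rV[R]_p) f : smooth U f -> smooth U (cutoff U f).
Proof.
move=> sf; apply: smooth_eq (oset_open U) _ sf => x Ux.
by rewrite /cutoff asboolT.
Qed.

Lemma cutoff_out (U : opens 'rV[R]_p) f x : ~ oset U x -> cutoff U f x = 0.
Proof. by move=> Ux; rewrite /cutoff asboolF. Qed.

Definition mk_smooth (U : opens 'rV[R]_p) f (sf : smooth U f) : smooth_fun U :=
  SmoothFun (cutoff_smooth sf) (@cutoff_out U f).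

Lemma mk_smoothE (U : opens 'rV[R]_p) f (sf : smooth U f) x : oset U x -> mk_smooth sf x = f x.
Proof. by move=> Ux; rewrite /= /cutoff asboolT. Qed.

Section Ring.
Variable U : opens 'rV[R]_p.
Implicit Types f g h : smooth_fun U.

Let oU := oset_open U.

Definition smooth_scal (c : R[i]) := mk_smooth (smooth_cst (p := p) U c).
Definition smooth_fadd f g :=
  mk_smooth (smooth_add oU (smooth_valP f) (smooth_valP g)).
Definition smooth_fmul f g :=
  mk_smooth (smooth_mul oU (smooth_valP f) (smooth_valP g)).
Definition smooth_fopp f := smooth_fmul (smooth_scal (-1)) f.

Local Ltac ptw := let x := fresh "x" in let Ux := fresh "Ux" in
  apply: smooth_fun_ext => x Ux; rewrite ?(mk_smoothE _ Ux).

Let addA : associative smooth_fadd.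
Proof. by move=> f g h; ptw; rewrite addrA. Qed.
Let addC : commutative smooth_fadd.
Proof. by move=> f g; ptw; rewrite addrC. Qed.
Let add0 : left_id (smooth_scal 0) smooth_fadd.
Proof. by move=> f; ptw; rewrite add0r. Qed.
Let addN : left_inverse (smooth_scal 0) smooth_fopp smooth_fadd.
Proof. by move=> f; ptw; rewrite mulN1r addNr. Qed.

HB.instance Definition _ :=
  GRing.isZmodule.Build (smooth_fun U) addA addC add0 addN.

Let mulA : associative smooth_fmul.
Proof. by move=> f g h; ptw; rewrite mulrA. Qed.
Let mulC : commutative smooth_fmul.
Proof. by move=> f g; ptw; rewrite mulrC. Qed.
Let mul1 : left_id (smooth_scal 1) smooth_fmul.
Proof. by move=> f; ptw; rewrite mul1r. Qed.
Let mulr_1 : right_id (smooth_scal 1) smooth_fmul.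
Proof. by move=> f; ptw; rewrite mulr1. Qed.
Let mulDl : left_distributive smooth_fmul +%R.
Proof. by move=> f g h; ptw; rewrite mulrDl. Qed.
Let mulDr : right_distributive smooth_fmul +%R.
Proof. by move=> f g h; ptw; rewrite mulrDr. Qed.

HB.instance Definition _ :=
  GRing.Zmodule_isPzRing.Build (smooth_fun U) mulA mul1 mulr_1 mulDl mulDr.

Let scal_D (c d : R[i]) : smooth_scal (c + d) = smooth_scal c + smooth_scal d.
Proof. by ptw. Qed.
Let scal_M (c d : R[i]) : smooth_scal (c * d) = smooth_scal c * smooth_scal d.
Proof. by ptw. Qed.
Let odd_a f g : f = - f -> g = - g -> f * g = - (g * f).
Proof.
move=> fN _; have f0 x : oset U x -> f x = 0.
  move=> Ux; have : f x = - f x.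
    by rewrite {1}fN (mk_smoothE _ Ux) (mk_smoothE _ Ux) mulN1r.
  move=> E; have : f x *+ 2 == 0 by rewrite mulr2n {1}E addNr.
  by rewrite mulrn_eq0 /= => /eqP.
by ptw; rewrite f0 // !(mul0r, mulr0).
Qed.

HB.instance Definition _ := isSuperAlg.Build R (smooth_fun U)
  (scal := smooth_scal) (parity := id)
  scal_D scal_M erefl (fun c f => mulC _ f)
  (fun _ _ => erefl) (fun _ _ => erefl) (fun _ => erefl) (fun _ => erefl)
  (fun x y _ => mulC x y) odd_a.

End Ring.

Definition smooth_res (U V : opens 'rV[R]_p) (VU : V `<=` U)
    (f : smooth_fun U) : smooth_fun V :=
  mk_smooth (smooth_sub VU (smooth_valP f)).

Program Definition smooth_space : superspace R := {|
  spt := 'rV[R]_p;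
  sec := fun U => smooth_fun U : superAlgType R;
  res := smooth_res
|}.
Next Obligation.
move=> U V VU; split=> [f g|f g|//|c]; apply: smooth_fun_ext => x Vx;
  by rewrite !(mk_smoothE _ Vx) ?(mk_smoothE _ (VU _ Vx)).
Qed.
Next Obligation.
by move=> U UU f; apply: smooth_fun_ext => x Ux; rewrite mk_smoothE.
Qed.
Next Obligation.
by move=> U V W VU WV WU f; apply: smooth_fun_ext => x Wx;
  rewrite !mk_smoothE //; exact: WV.
Qed.
Next Obligation.
move=> J U V VU cov f g fg; apply: smooth_fun_ext => x /cov[i Vx].
by have /(congr1 (fun h : smooth_fun (V i) => h x)) := fg i; rewrite !mk_smoothE.
Qed.
Next Obligation.
move=> J U V VU cov s sc.
pose F x := if pselect (exists i, oset (V i) x) is left e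
  then s (sval (cid e)) x else 0.
have FE i x : oset (V i) x -> F x = s i x.
  move=> Vx; rewrite /F; case: pselect => [e|[]]; last by exists i.
  case: (cid e) => j Vj /=.
  have oW : open (V i `&` V j) by apply: openI; exact: oset_open.
  have := sc i j (Opens oW) (@subIsetl _ _ _) (@subIsetr _ _ _).
  by move=> /(congr1 (fun h : smooth_fun _ => h x)); rewrite !mk_smoothE.
have sF : smooth U F.
  apply: smooth_local => x /cov[i Vx]; exists (V i); split=> //.
    exact: oset_open.
  apply: smooth_eq (oset_open _) _ (smooth_valP (s i)) => y Vy.
  by rewrite (FE i).
exists (mk_smooth sF) => i; apply: smooth_fun_ext => x Vx.
have Ux := VU i x Vx.
by rewrite (mk_smoothE _ Vx) (mk_smoothE _ Ux) (FE i x Vx).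
Qed.

End SmoothSections.
(** * cs manifolds *)

Section CsManifolds.
Variable R : realType.

(* The affine superspace R^p with sheaf C^infty (x) Lambda((C^q)^* ). *)
Definition model (p q : nat) : superspace R :=
  iter q (@odd_line R) (smooth_space R p).

(* The locality of the stalks follows from the local isomorphisms. *)
Definition cs_manifold (T : superspace R) :=
  forall x : T, exists (p q : nat) (U : opens T) (V : opens (model p q)),
    oset U x /\ isomorphic (open_subspace U) (open_subspace V).

End CsManifolds.

(** * The even Cartan subspace *)

(* Elements of a are given by their coordinates in the basis h_1, h_2. *)
Section Cartan.
Variable R : realType.

Notation C := R[i].
Notation a_ := 'rV[C]_2.

Definition hplus : a_ := const_mx 1.

Definition coordinate (j : 'I_2) (a : a_) : C := a 0 j.

Let coordinate_scalar j : scalar (coordinate j).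
Proof. by move=> c a b; rewrite /coordinate !mxE. Qed.
HB.instance Definition _ j :=
  GRing.isLinear.Build C a_ C *%R (coordinate j) (coordinate_scalar j).

Definition alpha : {scalar a_} := coordinate 0 \- coordinate 1.

(* (m_alpha / 2) alpha, with m_alpha = -2 since n is purely odd of dimension 2 *)
Definition rho : {scalar a_} := \- alpha.

(* A(a_R), in the coordinates of the basis h_1, h_2; its T-valued points are
   the morphisms from T to it. *)
Definition affine_aR : superspace R := smooth_space R 2.

Definition exp_form (mu : {scalar a_}) : global affine_aR :=
  @mk_smooth R 2 (full _) _
    (smooth_cexp openT (smooth_linear mu openT)).

Variable S : superspace R.
Implicit Types h : morphism S affine_aR.

(* e^{mu(h)} and sinh(mu(h)) *)
Definition exp_at (mu : {scalar a_}) h : global S :=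
  pull_global h (exp_form mu).

Definition sinh_at (mu : {scalar a_}) h : global S :=
  scal (2^-1) * (exp_at mu h - exp_at (\- mu) h).

End Cartan.

(** * The supergroups, through their functors of points *)

Section Supermatrices.
Variables (R : realType) (A : superAlgType R).

Definition mx2 (a b c d : A) : 'M[A]_2 :=
  \matrix_(i < 2, j < 2)
    if i == 0 then (if j == 0 then a else b) else (if j == 0 then c else d).

(* pairs of 1|1 supermatrices *)
Definition mxpair : Type := ('M[A]_2 * 'M[A]_2)%type.

Implicit Types g : mxpair.

Definition mxpair_mul g g' : mxpair := (g.1 *m g'.1, g.2 *m g'.2).

(* the even part of gl(1|1) (x) A *)
Definition even_gl (x : 'M[A]_2) :=
  [/\ is_even (x 0 0), is_odd (x 0 1), is_odd (x 1 0) & is_even (x 1 1)].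

(* a_1 h_1 + a_2 h_2 *)
Definition cartan_mx (a : 'rV[R[i]]_2) : mxpair :=
  let d := mx2 (scal (a 0 0)) 0 0 (scal (a 0 1)) in (d, - d).

(* the even part of n (x) A, n being the root space of alpha *)
Definition in_n (x : mxpair) :=
  [/\ even_gl x.1, even_gl x.2 &
    forall a : 'rV[R[i]]_2,
      (cartan_mx a).1 *m x.1 - x.1 *m (cartan_mx a).1
        = map_mx ( *%R (scal (alpha R a))) x.1 /\
      (cartan_mx a).2 *m x.2 - x.2 *m (cartan_mx a).2
        = map_mx ( *%R (scal (alpha R a))) x.2].

(* [x.1] and [x.2] square to zero, so that 1 + x is the exponential of x. *)
Definition in_N g := exists x : mxpair, in_n x /\ g = (1%:M + x.1, 1%:M + x.2).

End Supermatrices.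

Section Supergroups.
Variables (R : realType) (S : superspace R).

Notation mxpairS := (mxpair (global S)).
Implicit Types g k m n : mxpairS.

Definition in_G g :=
  [/\ even_gl g.1, even_gl g.2 &
    forall x : S, exists (z : R[i]) (r s : R),
      [/\ z != 0, 0 < r & 0 < s] /\
      [/\ has_value (g.1 0 0) x z, has_value (g.1 1 1) x r%:C,
          has_value (g.2 0 0) x (conjc z)^-1 & has_value (g.2 1 1) x s%:C]].

Definition in_K k :=
  [/\ k.2 = k.1, even_gl k.1 &
    forall x : S, exists (z : R[i]) (r : R),
      [/\ `|z| = 1, 0 < r, has_value (k.1 0 0) x z
        & has_value (k.1 1 1) x r%:C]].

Definition in_M m := [/\ in_K m, m.1 0 1 = 0 & m.1 1 0 = 0].

(* e^h *)
Definition exp_pt (h : morphism S (affine_aR R)) : mxpairS :=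
  let e mu := exp_at mu h in
  (mx2 (e (coordinate 0)) 0 0 (e (coordinate 1)),
   mx2 (e (\- coordinate 0)) 0 0 (e (\- coordinate 1))).

Definition iwasawa g (h : morphism S (affine_aR R)) :=
  in_G g /\ exists k n, [/\ in_K k, in_N n &
    g = mxpair_mul (mxpair_mul k (exp_pt h)) n].

(* H(g); the Iwasawa decomposition says that it is defined, uniquely, for
   every point g of G. *)
Definition iwasawa_H g : option (morphism S (affine_aR R)) :=
  if pselect (exists h, iwasawa g h) is left e then Some (sval (cid e))
  else None.

End Supergroups.

(** * The homogeneous superspace K/M *)

(* Every point of K is uniquely (1 xi; eta 1) m with xi, eta odd and m a point
   of M, so that K/M is the affine superspace A^{0|2} with coordinates xi, eta,
   and the matrix (1 xi; eta 1) is a section of K -> K/M.  The superfunctions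
   on T x K/M are f0 + f1 xi + (f2 + f3 xi) eta with fi superfunctions on T,
   that is, ((f0, f1), (f2, f3)). *)
Section KM.
Variable R : realType.

Definition times_KM (T : superspace R) : superspace R := odd_line (odd_line T).

Section Algebra.
Variable A : superAlgType R.

Notation A2 := (adjoin (adjoin A)).

Definition KM_emb (f : A) : A2 := adjoin_emb (adjoin_emb f).
Definition KM_xi : A2 := adjoin_emb (adjoin_var A).
Definition KM_eta : A2 := adjoin_var (adjoin A).

Definition KM_section (xi eta : A2) : mxpair A2 :=
  (mx2 1 xi eta 1, mx2 1 xi eta 1).

Definition KM_emb_pt (g : mxpair A) : mxpair A2 :=
  (map_mx KM_emb g.1, map_mx KM_emb g.2).

(* the superfunction f with xi', eta' substituted for xi, eta *)
Definition KM_subst (f : A2) (xi' eta' : A2) : A2 :=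
  KM_emb f.1.1 + KM_emb f.1.2 * xi' +
  (KM_emb f.2.1 + KM_emb f.2.2 * xi') * eta'.

(* The Berezinian densities on K/M are the w D(xi, eta), with w a superfunction
   on K/M; the integral of a superfunction f on T x K/M along K/M is the
   coefficient of xi eta in w f. *)
Definition KM_integral (w : adjoin (adjoin R[i])) (f : A2) : A :=
  let w' : A2 := ((scal w.1.1, scal w.1.2), (scal w.2.1, scal w.2.2)) in
  (w' * f).2.2.

End Algebra.

(* The left translation by a point k of K maps the coset with coordinates
   (xi, eta) to the one with coordinates (xi', eta') determined by
   k (1 xi; eta 1) = (1 xi'; eta' 1) m. *)
Definition K_invariant (w : adjoin (adjoin R[i])) :=
  forall (S : superspace R), cs_manifold S ->
  forall k : mxpair (global S), in_K k ->
  forall (xi' eta' : global (times_KM S)) (m : mxpair (global (times_KM S))),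
    is_odd xi' -> is_odd eta' -> in_M m ->
    mxpair_mul (KM_emb_pt k) (KM_section (KM_xi _) (KM_eta _))
      = mxpair_mul (KM_section xi' eta') m ->
  forall f : global (times_KM S),
    KM_integral w (KM_subst f xi' eta') = KM_integral w f.

(* The integral over K/M of e^{(lambda - rho)(H(g k))}, for a T-valued point g
   of G; None never occurs for such a g. *)
Definition spherical (w : adjoin (adjoin R[i])) (lambda : {scalar 'rV[R[i]]_2})
    (T : superspace R) (g : mxpair (global T)) : global T :=
  let gk : mxpair (global (times_KM T)) :=
    mxpair_mul (KM_emb_pt g) (KM_section (KM_xi _) (KM_eta _)) in
  if iwasawa_H gk is Some h then KM_integral w (exp_at (lambda \- rho R) h)
  else 0.

End KM.

(* Main.v *)
Require Import Defs.
From mathcomp Require Import all_boot all_order all_algebra.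
From mathcomp Require Import complex.
From mathcomp Require Import all_classical all_reals all_analysis.
From mathcomp Require Import ring.

(* For g = e^h one solves the Iwasawa equations over T x K/M explicitly: with
   c = 1 - e^{-2 alpha(h)} one finds
     H(g k) = h + (c / 2) xi eta h^+
   for k = (1 xi; eta 1).  As xi eta squares to zero and rho(h^+) = 0, this gives
     e^{(lambda - rho)(H(g k))}
       = e^{(lambda + alpha)(h)} (1 + (c / 2) lambda(h^+) xi eta),
   and the coefficient of xi eta is lambda(h^+) e^{lambda(h)} sinh alpha(h).  The
   density - D(xi, eta) is K-invariant because the Berezinian of the action of K
   on the coordinates (xi, eta) is 1.

   The value of e^{mu(H)} must not depend on the choice of the point H of the
   affine space.  The equations determine the pullbacks of e^{- 2 x_1} and
   e^{2 x_2} under H; a morphism to R^2 is determined on all exponentials by these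
   two, since on a cs manifold sections are separated by algebra morphisms to
   Grassmann algebras, and such a morphism composed with a pullback takes an entire
   function to its Taylor polynomial in a nilpotent element. *)

Set Implicit Arguments.
Unset Strict Implicit.
Unset Printing Implicit Defensive.

Import Order.TTheory GRing.Theory Num.Theory numFieldNormedType.Exports.

Local Open Scope classical_set_scope.
Local Open Scope ring_scope.
Local Open Scope complex_scope.

(** * Supermatrix algebra *)

Section SuperAlgebra.
Variables (R : realType) (A : superAlgType R).
Implicit Types x y : A.

Lemma mx2_mul (a b c d a' b' c' d' : A) :
  mx2 a b c d *m mx2 a' b' c' d' =
  mx2 (a * a' + b * c') (a * b' + b * d') (c * a' + d * c') (c * b' + d * d').
Proof.
apply/matrixP => i j; rewrite !mxE !big_ord_recl big_ord0 addr0 !mxE /=.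
by case: ifP => _; case: ifP.
Qed.

Lemma mx2_eta (M : 'M[A]_2) : M = mx2 (M 0 0) (M 0 1) (M 1 0) (M 1 1).
Proof.
have o2 (i : 'I_2) : i = if i == 0 then 0 else 1 :> 'I_2.
  by apply: val_inj; case: i => [[|[|]]].
apply/matrixP => i j; rewrite !mxE {1}(o2 i) {1}(o2 j).
by case: (i == 0); case: (j == 0).
Qed.

Lemma mx2_inj (a b c d a' b' c' d' : A) :
  mx2 a b c d = mx2 a' b' c' d' -> [/\ a = a', b = b', c = c' & d = d'].
Proof.
move=> /matrixP e.
by split; [have := e 0 0|have := e 0 1|have := e 1 0|have := e 1 1]; rewrite !mxE.
Qed.

Lemma mul_cancel_r x y y' z : y * y' = 1 -> x * y = z -> x = z * y'.
Proof. by move=> yy' <-; rewrite -mulrA yy' mulr1. Qed.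

Lemma map_mx2 (B : superAlgType R) (f : A -> B) (a b c d : A) :
  map_mx f (mx2 a b c d) = mx2 (f a) (f b) (f c) (f d).
Proof.
by apply/matrixP => i j; rewrite !mxE; case: ifP => _; case: ifP.
Qed.

End SuperAlgebra.

(** * Action of K on the coordinates of K/M *)

Section KMAlgebra.
Variables (R : realType) (A : superAlgType R).
Implicit Types x y : A.

Lemma even_inv x y : is_even x -> x * y = 1 -> is_even y /\ y * x = 1.
Proof.
move=> ex xy; have yx : y * x = 1 by rewrite -(even_central _ _ ex).
split=> //; rewrite /is_even -[LHS]mul1r -yx -mulrA.
by rewrite -{1}ex -parityM xy parity1 mulr1.
Qed.

Lemma odd_sqr x : is_odd x -> x * x = 0.
Proof.
move=> ox; apply: Defs.double_inj; rewrite {2}(odd_anticomm _ _ ox ox).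
by rewrite subrr addr0.
Qed.

(** The two coordinates transform separately, by fractional linear maps: [X] is (p xi + q)(r xi +
    s)^-1, affine in xi, and [Y] is (r + s eta)(p + q eta)^-1, affine in eta. Their slopes are the
    Berezinian of (p q; r s) and its inverse, so the coefficient of xi eta is preserved. *)
Lemma berezin_invariance (p q r s p' s' : A)
  (X Y m1 m2 : adjoin (adjoin A)) :
  is_even p -> is_odd q -> is_odd r -> is_even s -> p * p' = 1 -> s * s' = 1 ->
  map_mx (@KM_emb R A) (mx2 p q r s) *m mx2 1 (KM_xi A) (KM_eta A) 1
    = mx2 1 X Y 1 *m mx2 m1 0 0 m2 ->
  forall f, KM_integral ((-1, 0), (0, 0)) (KM_subst f X Y) =
            KM_integral ((-1, 0), (0, 0)) f.
Proof.
move=> ep oq or es pp' ss'.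
rewrite map_mx2 !mx2_mul.
move=> /mx2_inj []; rewrite !(mulr0, mulr1, mul1r, addr0, add0r) => <- e1 e2 m11.
rewrite -m11 in e1.
move: e1 e2.
case: X => [[x0 x1] [x2 x3]]; case: Y => [[y0 y1] [y2 y3]].
have simp0 := (mulr0, mul0r, mulr1, mul1r, addr0, add0r, parity0 A, parity1 A,
  oppr0).
case; rewrite !simp0 !es => q_ p_ x2_ x3_.
case; rewrite !simp0 !ep => r_ y1_ s_ y3_.
have [ep' p'p] := even_inv ep pp'; have [es' s's] := even_inv es ss'.
have x2E : x2 = 0 by rewrite (mul_cancel_r ss' (esym x2_)) mul0r.
have x3E : x3 = 0.
  by move: x3_; rewrite x2E mul0r add0r => /esym/(mul_cancel_r ss') ->; rewrite mul0r.
have y1E : y1 = 0 by rewrite (mul_cancel_r pp' (esym y1_)) mul0r.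
have y3E : y3 = 0.
  by move: y3_; rewrite y1E mul0r add0r => /esym/(mul_cancel_r pp') ->; rewrite mul0r.
have x0E := mul_cancel_r ss' (esym q_).
have y0E := mul_cancel_r pp' (esym r_).
have x1E : x1 = (p - q * s' * r) * s'.
  by apply: (mul_cancel_r ss'); rewrite p_ x0E [_ + _ - _]addrAC subrr add0r.
have y2E : y2 = (s - r * p' * q) * p'.
  by apply: (mul_cancel_r pp'); rewrite s_ y0E [_ + _ - _]addrAC subrr add0r.
have ev : is_even y2.
  rewrite /is_even y2E parityM ep' parityD es parityN !parityM or oq ep'.
  by rewrite !(mulNr, mulrN) opprK.
(* Exchanging the even factors p' and s' turns the product of the slopes into (1 - z)(1 + z) with z
   = p' s' q r, and z squares to zero because q and r are odd. *)
have xy : x1 * y2 = 1.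
  have et : is_even (q * r) by rewrite /is_even parityM oq or mulrNN.
  have tt : q * r * (q * r) = 0
    by rewrite mulrA -(mulrA q) (odd_anticomm _ _ or oq) mulrN mulrA odd_sqr //
      mul0r oppr0 mul0r.
  have u_ : q * s' * r = s' * (q * r).
    by rewrite -(even_central _ _ es') mulrA.
  have v_ : r * p' * q = - (p' * (q * r)).
    by rewrite -(even_central _ _ ep') -mulrA (odd_anticomm _ _ or oq) mulrN.
  pose z := p' * s' * (q * r).
  have zz : z * z = 0.

    by rewrite /z -mulrA [X in _ * X](even_central _ _ et) -[X in _ * X]mulrA tt !mulr0.
  have -> : x1 * y2 = ((p - q * s' * r) * p') * ((s - r * p' * q) * s').
    rewrite x1E y2E -!mulrA; congr (_ * _).
    rewrite (even_central s') // [RHS](even_central p') // -!mulrA.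
    by rewrite (even_central p' s').
  have -> : (p - q * s' * r) * p' = 1 - z.
    by rewrite mulrBl pp' u_ -(even_central _ _ ep') /z -!mulrA.
  have -> : (s - r * p' * q) * s' = 1 + z.
    rewrite mulrBl ss' v_ mulNr opprK -(even_central _ _ es') (mulrA s').
    by rewrite (even_central s' p') // /z.
  by rewrite mulrDr mulr1 mulrBl mul1r zz subr0 subrK.
case=> [[f0 f1] [f2 f3]].
rewrite /KM_integral /KM_subst /KM_emb /= x2E x3E y1E y3E !simp0 ev.
by rewrite scal0 !mul0r -(mulrA f3) xy mulr1.
Qed.
End KMAlgebra.

(** * Elimination in the Iwasawa equations *)

Section Iwasawa.
Variables (R : realType) (A : superAlgType R).
Implicit Types x y : A.

Lemma evenM x y : is_even x -> is_even y -> is_even (x * y).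
Proof. by move=> ex ey; rewrite /is_even parityM ex ey. Qed.

(** Since w is a left multiple of xi, the product w xi vanishes, so that Q xi = v xi. Inserting this
    into the equation for w decouples the system. *)
Lemma iwasawa_solve (u v w Q xi eta : A) :
  is_even v -> is_even Q -> is_odd xi ->
  Q = v * (1 - eta * w) -> w = xi - u * (Q * xi) ->
  Q = v * (1 - eta * ((1 - u * v) * xi)).
Proof.
move=> ev eQ ox Qe we.
have Qxi : Q * xi = v * xi.
  rewrite Qe -mulrA mulrBl mul1r we -mulrA mulrBl (odd_sqr ox) -!mulrA.
  by rewrite (odd_sqr ox) !mulr0 subr0 mulr0 subr0.
by rewrite {1}Qe {1}we Qxi mulrA mulrBl mul1r.
Qed.

(** The two components share the factor (p q; r s). Its first column is read off from the first
    equation and its second column from the second one; eliminating it couples Bb^2 with nu and Ai^2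
    with mu, in the form solved by [iwasawa_solve]. Squares arise because each entry carries a
    factor Ai or Bb and meets it again in the other equation. *)
Lemma iwasawa_unique_squares (a a' b b' p q r s Aa Ai Bb Bi nu mu xi eta : A) :
  is_even a -> is_even a' -> is_even b -> is_even b' ->
  is_even Aa -> is_even Ai -> is_even Bb -> is_even Bi ->
  is_odd xi -> is_odd eta ->
  a * a' = 1 -> b * b' = 1 -> Aa * Ai = 1 -> Bb * Bi = 1 ->
  mx2 a (a * xi) (b * eta) b
    = mx2 p q r s *m mx2 Aa 0 0 Bb *m mx2 1 nu 0 1 ->
  mx2 a' (a' * xi) (b' * eta) b'
    = mx2 p q r s *m mx2 Ai 0 0 Bi *m mx2 1 0 mu 1 ->
  Bb * Bb = b * b * (1 - eta * ((1 - a' * a' * (b * b)) * xi)) /\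
  Ai * Ai = a' * a' * (1 - xi * ((1 - b * b * (a' * a')) * eta)).
Proof.
move=> ea ea' eb eb' eAa eAi eBb eBi ox oe aa' bb' AA BB.
rewrite !mx2_mul => /mx2_inj [] + + + + /mx2_inj [].
rewrite !(mulr0, mulr1, mul1r, addr0, add0r) => e1 e2 e3 e4 f1 f2 f3 f4.
have pE := mul_cancel_r AA (esym e1); have rE := mul_cancel_r AA (esym e3).
have [_ BB'] := even_inv eBb BB.
have qE := mul_cancel_r BB' (esym f2); have sE := mul_cancel_r BB' (esym f4).
have [_ a'a] := even_inv ea aa'; have [_ b'b] := even_inv eb bb'.
rewrite -e1 -f2 qE in e2 f1; rewrite -e3 -f4 sE in e4 f3.
rewrite pE in f1; rewrite rE in f3.
have nuE : nu = xi - a' * a' * (Bb * Bb * xi).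
  rewrite -[LHS]mul1r -a'a -mulrA.
  have -> : a * nu = a * xi - a' * xi * Bb * Bb by rewrite e2 addrK.
  rewrite (even_central (Bb * Bb) xi (evenM eBb eBb)).
  by rewrite mulrBr !mulrA a'a mul1r.
have QE : Bb * Bb = b * b * (1 - eta * nu).
  rewrite -[LHS]mul1r -[in LHS]bb' -!mulrA; congr (_ * _).
  have -> : b' * (Bb * Bb) = b - b * eta * nu.
    by rewrite [X in X - _]e4 addrAC subrr add0r mulrA.
  by rewrite mulrBr mulr1 !mulrA.
have muE : mu = eta - b * b * (Ai * Ai * eta).
  rewrite -[LHS]mul1r -bb' -mulrA.
  have -> : b' * mu = b' * eta - b * eta * Ai * Ai by rewrite f3 addrAC subrr add0r.
  rewrite (even_central (Ai * Ai) eta (evenM eAi eAi)).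
  by rewrite mulrBr !mulrA bb' mul1r.
have PE : Ai * Ai = a' * a' * (1 - xi * mu).
  rewrite -[LHS]mul1r -[in LHS]a'a -!mulrA; congr (_ * _).
  have -> : a * (Ai * Ai) = a' - a' * xi * mu by rewrite [X in X - _]f1 addrK mulrA.
  by rewrite mulrBr mulr1 !mulrA.
by split; [apply: iwasawa_solve nuE|apply: iwasawa_solve muE] => //; exact: evenM.
Qed.
End Iwasawa.

(** * Even and odd superfunctions on T x K/M *)

Section KMElements.
Variables (R : realType) (A : superAlgType R).
Implicit Types x y u v : A.

(* x + y xi eta and u xi + v eta *)
Definition KM_even x y : adjoin (adjoin A) := ((x, 0), (0, y)).
Definition KM_odd u v : adjoin (adjoin A) := ((0, u), (v, 0)).

Let simp0 := (mul0r, mulr0, addr0, add0r, parity0, oppr0, mulr1, mul1r,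
  @opprK A).

Lemma KM_even_even x y : is_even x -> is_even y -> is_even (KM_even x y).
Proof. by move=> ex ey; congr pair; congr pair; rewrite /= ?(ex, ey, simp0). Qed.

Lemma KM_odd_odd u v : is_even u -> is_even v -> is_odd (KM_odd u v).
Proof. by move=> eu ev; congr pair; congr pair; rewrite /= ?(eu, ev, simp0). Qed.

Lemma KM_embE x : KM_emb x = KM_even x 0.
Proof. by []. Qed.

Lemma KM_xiE : KM_xi A = KM_odd 1 0. Proof. by []. Qed.
Lemma KM_etaE : KM_eta A = KM_odd 0 1. Proof. by []. Qed.

Lemma KM_evenD x y x' y' : KM_even x y + KM_even x' y' = KM_even (x + x') (y + y').
Proof. by congr pair; congr pair; rewrite /= ?simp0. Qed.

Lemma KM_oddD u v u' v' : KM_odd u v + KM_odd u' v' = KM_odd (u + u') (v + v').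
Proof. by congr pair; congr pair; rewrite /= ?simp0. Qed.

Lemma KM_evenM x y x' y' : is_even x' ->
  KM_even x y * KM_even x' y' = KM_even (x * x') (x * y' + y * x').
Proof. by move=> ex'; congr pair; congr pair; rewrite /= ?simp0 ?ex'. Qed.

Lemma KM_even_odd x y u v : is_even u -> is_even v ->
  KM_even x y * KM_odd u v = KM_odd (x * u) (x * v).
Proof. by move=> eu ev; congr pair; congr pair; rewrite /= ?simp0 ?(eu, ev, simp0). Qed.

Lemma KM_odd_even u v x y : is_even x ->
  KM_odd u v * KM_even x y = KM_odd (u * x) (v * x).
Proof. by move=> ex; congr pair; congr pair; rewrite /= ?simp0 ?(ex, simp0). Qed.

Lemma KM_oddM u v u' v' : is_even u' -> is_even v' ->
  KM_odd u v * KM_odd u' v' = KM_even 0 (u * v' - v * u').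
Proof.
by move=> eu ev; congr pair; congr pair; rewrite /= ?simp0 ?(eu, ev, simp0) // mulrN.
Qed.

(** The explicit decomposition. For a = e^{x_1} and b = e^{x_2} one has g = e^{-alpha(h)} and e = c
    / 2; the diagonal factors are the exponential of h + e xi eta h^+, and the entries of the factor
    in N are c xi and c eta. *)
Lemma KM_iwasawa (a a' b b' g c e : A) :
  is_even a -> is_even a' -> is_even b -> is_even b' -> is_even e ->
  a * a' = 1 -> b * b' = 1 -> g = a' * b -> c = 1 - g * g -> e + e = c ->
  let k := mx2 (KM_even 1 (- e)) (KM_odd g 0) (KM_odd 0 g) (KM_even 1 e) in
  (mx2 (KM_emb a) (KM_emb a * KM_xi A) (KM_emb b * KM_eta A) (KM_emb b),
   mx2 (KM_emb a') (KM_emb a' * KM_xi A) (KM_emb b' * KM_eta A) (KM_emb b'))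
  = mxpair_mul
      (mxpair_mul (k, k)
        (mx2 (KM_even a (a * e)) 0 0 (KM_even b (b * e)),
         mx2 (KM_even a' (- (a' * e))) 0 0 (KM_even b' (- (b' * e)))))
      (mx2 1 (KM_odd c 0) 0 1, mx2 1 0 (KM_odd 0 c) 1).
Proof.
move=> ea ea' eb eb' ee aa' bb' gE cE eeE k.
have eg : is_even g by rewrite gE; exact: evenM.
have ec : is_even c by rewrite -eeE /is_even parityD ee.
have e0 : is_even (0 : A) by exact: parity0.
have e1 : is_even (1 : A) by exact: parity1.
have [_ a'a] := even_inv ea aa'; have [_ b'b] := even_inv eb bb'.
have ag : a * g = b by rewrite gE mulrA aa' mul1r.
have b'g : b' * g = a' by rewrite gE (even_central _ _ ea') mulrA b'b mul1r.
rewrite /mxpair_mul /= /k KM_xiE KM_etaE !KM_embE !mx2_mul ?(mulr0, addr0, mulr1, add0r).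
rewrite !(KM_evenM, KM_even_odd, KM_odd_even, KM_oddM) // ?simp0.
rewrite !(KM_evenM, KM_even_odd, KM_odd_even, KM_oddM, KM_evenD, KM_oddD) // ?simp0.
congr pair; congr mx2; rewrite ?KM_evenD ?KM_oddD ?simp0 //.
- by rewrite mulNr (even_central _ _ ee) subrr.
- by rewrite cE mulrBr mulr1 mulrA ag (even_central _ _ eb) subrK.
- by rewrite (even_central _ _ eg) ag.
- by rewrite (even_central _ _ eg) ag (even_central _ _ ee) -mulrDr eeE addNr.
- by rewrite mulNr (even_central _ _ ee) -opprD -mulrDr eeE (even_central _ _ eg) b'g
    addNr.
- by rewrite (even_central _ _ eg) b'g.
- by rewrite cE mulrBr mulr1 mulrA b'g (even_central _ _ eg) addrC subrK.
- by rewrite (even_central _ _ ee) addNr.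
Qed.
End KMElements.

(** * Grassmann algebras and jets *)

Section Homs.
Variables (R : realType) (A B : superAlgType R) (f : A -> B).
Hypothesis fh : superalg_hom f.

Lemma homD : {morph f : x y / x + y}. Proof. by case: fh. Qed.
Lemma homM : {morph f : x y / x * y}. Proof. by case: fh. Qed.
Lemma hom_parity : {morph f : x / parity x}. Proof. by case: fh. Qed.
Lemma hom_scal (c : R[i]) : f (scal c) = scal c. Proof. by case: fh. Qed.
Lemma hom0 : f 0 = 0. Proof. by rewrite -(scal0 A) hom_scal scal0. Qed.
Lemma hom1 : f 1 = 1. Proof. by rewrite -(scal1 (s := A)) hom_scal scal1. Qed.
Lemma homN : {morph f : x / - x}.
Proof. by move=> x; apply: (addrI (f x)); rewrite -homD !subrr hom0. Qed.
Lemma homB : {morph f : x y / x - y}.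
Proof. by move=> x y; rewrite homD homN. Qed.
Lemma homX n : {morph f : x / x ^+ n}.
Proof. by move=> x; elim: n => [|n IH]; rewrite ?hom1 // !exprS homM IH. Qed.
Lemma hom_sum (I : Type) (r : seq I) (F : I -> A) :
  f (\sum_(i <- r) F i) = \sum_(i <- r) f (F i).
Proof. exact: (big_morph f homD hom0). Qed.
Lemma hom_even x : is_even x -> is_even (f x).
Proof. by move=> ex; rewrite /is_even -hom_parity ex. Qed.
Lemma hom_unit x : is_unit x -> is_unit (f x).
Proof. by move=> [y [xy yx]]; exists (f y); rewrite -!homM xy yx hom1. Qed.

End Homs.

Lemma hom_comp (R : realType) (A B C : superAlgType R) (g : B -> C) (f : A -> B) :
  superalg_hom g -> superalg_hom f -> superalg_hom (g \o f).
Proof.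
move=> [gD gM gp gs] [fD fM fp fs].
by split=> [x y|x y|x|c] /=; rewrite ?fD ?fM ?fp ?fs ?gD ?gM ?gp ?gs.
Qed.

Section AdjoinUnit.
Variables (R : realType) (A B : superAlgType R).

(** The part containing the odd variable is nilpotent, so the geometric series for the inverse stops
    after its linear term. *)
Lemma adjoin_unit (f : adjoin A) : is_unit f.1 -> is_unit f.
Proof.
case: f => f0 f1 /= [g0 [fg gf]]; exists (g0, - (g0 * f1 * parity g0)).
split; congr pair => //=.
  by rewrite mulrN !mulrA fg mul1r addNr.
by rewrite mulNr -(mulrA _ (parity g0)) -parityM gf parity1 mulr1 subrr.
Qed.

Lemma adjoin_unitW (f : adjoin A) : is_unit f -> is_unit f.1.
Proof. by case: f => f0 f1 [[g0 g1]] [[fg _] [gf _]]; exists g0. Qed.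

(** The binomial expansion has only two terms, since the odd variable squares to zero. *)
Lemma adjoin_even_exp (f : adjoin A) n : is_even f ->
  f ^+ n.+1 = (f.1 ^+ n.+1, f.1 ^+ n * f.2 *+ n.+1).
Proof.
case: f => f0 f1 [] /= ef0 of1.
elim: n => [|n IHn]; first by rewrite !expr1 expr0 mul1r mulr1n.
have pX k : is_even (f0 ^+ k).
  by elim: k => [|k IHk]; rewrite /is_even ?parity1 // exprS parityM IHk ef0.
rewrite exprS IHn; congr pair; rewrite /= -?exprS //.
rewrite pX -(even_central _ f1 (pX _)) mulrnAr mulrA -exprS -mulrSr.
by [].
Qed.

Definition adjoin_map (f : A -> B) (x : adjoin A) : adjoin B := (f x.1, f x.2).

Lemma adjoin_map_hom (f : A -> B) : superalg_hom f -> superalg_hom (adjoin_map f).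
Proof.
by move=> fh; split=> [x y|x y|x|c]; congr pair; rewrite /=
  ?(homD fh) ?(homM fh) ?(homN fh) ?(hom_parity fh) ?(hom_scal fh) ?(hom0 fh).
Qed.

End AdjoinUnit.

Section Grassmann.
Variable R : realType.

Fixpoint grassmann (q : nat) : superAlgType R :=
  if q is q'.+1 then adjoin (grassmann q') : superAlgType R else R[i].

Fixpoint body (q : nat) : grassmann q -> R[i] :=
  if q is q'.+1 then fun f => body f.1 else id.

Lemma body_hom q : superalg_hom (@body q).
Proof.
elim: q => [|q [bD bM bp bs]]; first by [].
by split=> /= [x y|x y|x|c]; rewrite ?(bD, bM, bp, bs).
Qed.

Lemma body_unit q (f : grassmann q) : body f != 0 -> is_unit f.
Proof.
elim: q f => [|q IH] f /= f0; first by exists f^-1; rewrite mulfV ?mulVf.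
by apply: adjoin_unit; exact: IH.
Qed.

(** By [adjoin_even_exp], each new odd variable raises the nilpotency order by at most one. *)
Lemma grassmann_nilp q (f : grassmann q) : is_even f -> body f = 0 -> f ^+ q.+1 = 0.
Proof.
elim: q f => [|q IH] f; first by move=> _ /= ->; rewrite expr1.
move=> ef b0; have /= ef1 := congr1 fst ef.
rewrite (adjoin_even_exp _ ef).
have e := IH f.1 ef1 b0; congr pair; first by rewrite exprS e mulr0.
by rewrite e mul0r mul0rn.
Qed.

End Grassmann.

Section UnitAt.
Variables (R : realType) (X : superspace R).

Definition unit_at (U : opens X) (f : sec U) (x : X) :=
  exists (W : opens X) (WU : W `<=` U), oset W x /\ is_unit (res WU f).

Lemma has_valueP (f : global X) (x : X) (c : R[i]) :
  has_value f x c <-> ~ unit_at (f - scal c) x.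
Proof.
split=> [h [W [WU [Wx u]]]|h V VT Vx u]; first exact: (h W WU Wx).
by apply: h; exists V, VT.
Qed.

End UnitAt.

(* [eps] is an algebra morphism from the germs at x to a Grassmann algebra, as given
   by the Taylor expansion in the odd coordinates at x. *)
Record is_jet (R : realType) (X : superspace R) (q : nat) (x : X)
    (eps : forall U : opens X, sec U -> grassmann R q) : Prop := IsJet {
  jet_hom : forall U, oset U x -> superalg_hom (eps U);
  jet_res : forall (U V : opens X) (VU : V `<=` U) (f : sec U),
    oset V x -> eps V (res VU f) = eps U f;
  jet_unit : forall (U : opens X) (f : sec U),
    oset U x -> body (eps U f) != 0 -> unit_at f x
}.

(** A substitute for local coordinates: jets exist at all points, with one number q of odd
    variables, and they separate sections. Unlike coordinates, this is transported directly along
    isomorphisms and open subspaces. *)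
Definition has_jets (R : realType) (X : superspace R) (U0 : set X) :=
  exists q : nat,
    (forall x, U0 x -> exists eps, @is_jet R X q x eps) /\
    forall (U : opens X), U `<=` U0 -> forall f : sec U,
      (forall x eps, oset U x -> is_jet x eps -> eps U f = 0 :> grassmann R q) ->
      f = 0.

(** * Jets on R^p *)

Section SmoothJets.
Variables (R : realType) (p : nat).

Lemma Ck_inv k (U : set 'rV[R]_p) (f : 'rV[R]_p -> R) : open U ->
  (forall x, U x -> f x != 0) -> Ck k U f -> Ck k U (fun x => (f x)^-1).
Proof.
move=> oU f0; elim: k => [|k IH] Cf.
  by split=> // x Ux; exact: (cvgV (f0 x Ux) (Ck_cont Cf Ux)).
split=> [x Ux|j]; first exact: (cvgV (f0 x Ux) (Ck_cont Cf Ux)).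
have [dj cj] := Cf.2 j; split=> [x Ux|].
  by apply: derivableV; [exact: f0|exact: dj].
have CV := IH (Ck_S Cf).
apply: Ck_eq oU _ (Ck_opp oU (Ck_mul oU (Ck_mul oU CV CV) cj)) => x Ux.
rewrite [RHS](deriveV (f0 x Ux) (dj x Ux)) -exprVn expr2 /GRing.scale /=.
by rewrite mulNr.
Qed.

Lemma smooth_inv (U : set 'rV[R]_p) (f : 'rV[R]_p -> R[i]) : open U ->
  (forall x, U x -> f x != 0) -> smooth U f -> smooth U (fun x => (f x)^-1).
Proof.
move=> oU f0 sf k; have [rf mf] := sf k.
pose n x := complex.Re (f x) * complex.Re (f x) + complex.Im (f x) * complex.Im (f x).
have n0 x : U x -> n x != 0.
  move=> /f0; rewrite /n; case: (f x) => a b /=; apply: contraNneq => /eqP.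
  rewrite -!expr2 paddr_eq0 ?sqr_ge0 // !sqrf_eq0 => /andP[/eqP-> /eqP->].
  by [].
have Cn : Ck k U (fun x => (n x)^-1).
  by apply: Ck_inv => //; apply: Ck_add; rewrite //; exact: Ck_mul.
split.
  apply: Ck_eq oU _ (Ck_mul oU rf Cn) => x Ux.
  by rewrite /n; case: (f x) => a b /=; rewrite -!expr2.
apply: Ck_eq oU _ (Ck_opp oU (Ck_mul oU mf Cn)) => x Ux.
by rewrite /n; case: (f x) => a b /=; rewrite -!expr2.
Qed.

Lemma smooth_eval_hom (U : opens 'rV[R]_p) x : oset U x ->
  superalg_hom ((fun f => f x) : smooth_fun U -> grassmann R 0).
Proof.
by move=> Ux; split=> [f g|f g|f|c] //; rewrite mk_smoothE.
Qed.

(** Without odd coordinates, evaluation is a jet: a smooth function is invertible on the open set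
    where it does not vanish. *)
Lemma smooth_jet (x : 'rV[R]_p) :
  @is_jet R (smooth_space R p) 0 x (fun U (f : smooth_fun U) => f x).
Proof.
split=> [U Ux|U V VU f Vx|U f Ux fx]; first exact: smooth_eval_hom.
  by rewrite mk_smoothE.
(* The squared modulus is real, continuous and has the same zeros as f; it shows that nonvanishing
   is an open condition. *)
pose n y := complex.Re (f y) * complex.Re (f y) + complex.Im (f y) * complex.Im (f y).
have nE y : (n y != 0) = (f y != 0).
  rewrite /n; case: (f y) => a b /=; rewrite eq_complex /= -!expr2.
  by rewrite paddr_eq0 ?sqr_ge0 // !sqrf_eq0.
have oU : open (oset U : set 'rV[R]_p) := oset_open U.
have oW : open ([set y | oset U y /\ f y != 0] : set 'rV[R]_p).
  rewrite openE => y [Uy fy].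
  have [rf mf] := smooth_valP f 0%N.
  have Cn : Ck 0 U n by apply: Ck_add => //; exact: Ck_mul.
  have cn := Ck_cont Cn Uy.
  rewrite -nE in fy.
  have := cvgr_neq0 (n y) cn fy.
  move=> h; have h2 := open_nbhs_nbhs (conj oU Uy).
  rewrite /interior; apply: filterS2 (h _) h2 => z nz Uz.
  by split=> //; rewrite -nE.
have WU : (Opens oW : opens (smooth_space R p)) `<=` U by move=> y [].
exists (Opens oW), WU; split; first by split.
have si : smooth (Opens oW : opens 'rV[R]_p) (fun y => (f y)^-1).
  apply: smooth_inv => // [y []//|].
  exact: smooth_sub WU (smooth_valP f).
exists (mk_smooth si); split; apply: smooth_fun_ext => y Wy;
  rewrite !mk_smoothE //; have [_ fy] := Wy; rewrite ?mulfV ?mulVf //.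
Qed.

Lemma smooth_has_jets : @has_jets R (smooth_space R p) setT.
Proof.
exists 0%N; split=> [x _|U _ f f0]; last first.
  apply: smooth_fun_ext => x Ux; rewrite [RHS]mk_smoothE //.
  exact: (f0 x _ Ux (smooth_jet x)).
by exists (fun U (f : smooth_fun U) => f x); exact: smooth_jet.
Qed.

End SmoothJets.

(** * Jets under adjunction of odd coordinates *)

Section JetTransport.
Variable R : realType.

Lemma odd_line_unit_at (X : superspace R) (U : opens X)
    (f : @sec R (odd_line X) U) (x : X) :
  @unit_at R X U f.1 x <-> @unit_at R (odd_line X) U f x.
Proof.
split=> -[W [WU [Wx u]]]; exists W, WU; split=> //.
  exact: adjoin_unit.
exact: (adjoin_unitW u).
Qed.

Lemma odd_line_jet (X : superspace R) q (x : X) eps : @is_jet R X q x eps ->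
  @is_jet R (odd_line X) q.+1 x (fun U f => adjoin_map (eps U) f).
Proof.
move=> [eh er eu]; split=> [U Ux|U V VU f Vx|U f Ux fx].
- exact/adjoin_map_hom/eh.
- by congr pair; exact: er.
- by apply/odd_line_unit_at; exact: eu fx.
Qed.

Lemma odd_line_has_jets (X : superspace R) (U0 : set X) :
  has_jets U0 -> @has_jets R (odd_line X) U0.
Proof.
move=> [q [ex sep]]; exists q.+1; split=> [x /ex[eps je]|U UU0 f f0].
  by exists (fun U f => adjoin_map (eps U) f); exact: odd_line_jet.
case: f f0 => f0 f1 f_0.
have e0 : f0 = 0.
  by apply: (sep U UU0) => x eps Ux je; case: (f_0 x _ Ux (odd_line_jet je)).
have e1 : f1 = 0.
  by apply: (sep U UU0) => x eps Ux je; case: (f_0 x _ Ux (odd_line_jet je)).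
by rewrite e0 e1.
Qed.

Lemma model_has_jets p q : @has_jets R (model R p q) setT.
Proof.
elim: q => [|q IH]; first exact: smooth_has_jets.
exact: (@odd_line_has_jets (model R p q) setT IH).
Qed.

End JetTransport.

(** * Jets on open subspaces, along isomorphisms and on cs manifolds *)

Section LocalJets.
Variable R : realType.

Lemma is_unit_res (X : superspace R) (U V : opens X) (VU : V `<=` U) (f : sec U) :
  is_unit f -> is_unit (res VU f).
Proof. exact/hom_unit/res_hom. Qed.

Section Subspace.
Variables (X : superspace R) (U : opens X).
Let S := open_subspace U.

Lemma set_val_open (W : opens X) : open ((set_val : S -> X) @^-1` W).
Proof. by exists W => //; exact: oset_open. Qed.

Definition opens_trace (W : opens X) : opens S := Opens (@set_val_open W).

Lemma opens_image_trace (W : opens X) : opens_image (opens_trace W) `<=` W.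
Proof. by move=> _ [y Wy <-]. Qed.

Lemma opens_trace_image (W : opens X) : W `<=` U -> W `<=` opens_image (opens_trace W).
Proof. by move=> WU x Wx; exists (exist _ x (mem_set (WU x Wx))). Qed.

Lemma is_jet_to_subspace q (y : S) eps : @is_jet R X q (val y) eps ->
  @is_jet R S q y (fun W f => eps (opens_image W) f).
Proof.
have im (W : opens S) : oset W y -> oset (opens_image W) (val y) by move=> Wy; exists y.
move=> [eh er eu]; split=> [W /im/eh//|V W WV f /im Wy|W f /im Wy fy].
  exact: er.
have [W' [W'W [W'y u]]] := eu _ _ Wy fy.
have W''W : opens_trace W' `<=` W.
  by move=> z /W'W[z' Wz' /val_inj <-].
exists (opens_trace W'), W''W; split=> //.
have := is_unit_res (@opens_image_trace W') u.
by rewrite (res_comp _ _ (opens_imageS W''W)).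
Qed.

Lemma is_jet_from_subspace q (y : S) eps : @is_jet R S q y eps ->
  @is_jet R X q (val y) (fun W f => eps (opens_trace W) (res (@opens_image_trace W) f)).
Proof.
move=> [eh er eu]; split=> [W Wy|V W WV f Wy|W f Wy fy].
- by apply: (@hom_comp _ _ _ _ (eps _)); [exact: eh|exact: res_hom].
- have TT : opens_trace W `<=` opens_trace V by move=> z /WV.
  rewrite -(er _ _ TT) //; congr (eps _ _).
  by rewrite /= (res_comp _ _ (subset_trans (@opens_image_trace W) WV))
    (res_comp _ _ (subset_trans (@opens_image_trace W) WV)).
have [W' [W'W [W'y]]] := eu (opens_trace W) _ Wy fy.
have W''W : opens_image W' `<=` W.
  by move=> _ [z /W'W Wz <-].
rewrite /= (res_comp _ _ W''W) => u.
by exists (opens_image W'), W''W; split=> //; exists y.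
Qed.

Lemma has_jets_to_subspace : @has_jets R X setT -> @has_jets R S setT.
Proof.
move=> [q [ex sep]]; exists q; split=> [y _|W _ f f0].
  have [//|eps je] := ex (val y) _.
  by exists (fun W f => eps (opens_image W) f); exact: is_jet_to_subspace.
apply: (sep (opens_image W)) => // x eps [y Wy yx] je.
by apply: (f0 y _ Wy (is_jet_to_subspace _)); rewrite -[val y]/(set_val y) yx.
Qed.

Lemma has_jets_from_subspace : @has_jets R S setT -> @has_jets R X U.
Proof.
move=> [q [ex sep]]; exists q; split=> [x Ux|W WU f f0].
  have [//|eps je] := ex (exist _ x (mem_set Ux)) _.
  by exists (fun W f => eps (opens_trace W) (res (@opens_image_trace W) f));
    exact: (is_jet_from_subspace je).
have r0 : res (@opens_image_trace W) f = 0.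
  apply: (sep (opens_trace W)) => // y eps Wy je.
  exact: (f0 (val y) _ Wy (is_jet_from_subspace je)).
have := congr1 (res (opens_trace_image WU)) r0.
rewrite (res_comp _ _ (@subset_refl _ W)) res_id => ->.
exact: hom0 (res_hom _).
Qed.

End Subspace.

(** A jet of Y at f(x) becomes a jet of X at x by composition with [T], the inverse of the sheaf map
    of f. *)
Lemma isomorphic_has_jets (X Y : superspace R) :
  isomorphic X Y -> @has_jets R Y setT -> @has_jets R X setT.
Proof.
move=> [f [[g [gc fg gf]] bij]] [q [ex sep]].
pose G (W : opens X) := opens_preimage gc W.
(* The preimage of [G W] under f has the same points as W but is another term; the restrictions
   along [FG] and [GF] identify the sections. *)
have FG (W : opens X) : opens_preimage (mfun_cont f) (G W) `<=` W.
  by move=> x /=; rewrite /preimage /= fg.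
have GF (W : opens X) : W `<=` opens_preimage (mfun_cont f) (G W).
  by move=> x Wx /=; rewrite /preimage /= fg.
have inj V : injective (pull f V) by exact: bij_inj.
have T_ (W : opens X) (s : sec W) : exists t, pull f (G W) t = res (@FG W) s.
  by have [h _ hK] := bij (G W); exists (h (res (@FG W) s)).
pose T (W : opens X) s := projT1 (cid (T_ W s)).
have TE W s : pull f (G W) (T W s) = res (@FG W) s := projT2 (cid (T_ W s)).
have T_hom W : superalg_hom (T W).
  have ph := pull_hom f (G W); have rh := res_hom (@FG W).
  split=> [s t|s t|s|c]; apply: inj.
  - by rewrite (homD ph) !TE (homD rh).
  - by rewrite (homM ph) !TE (homM rh).
  - by rewrite (hom_parity ph) !TE (hom_parity rh).
  - by rewrite (hom_scal ph) !TE (hom_scal rh).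
have T_res (U V : opens X) (VU : V `<=` U) (GVU : G V `<=` G U) s :
    T V (res VU s) = res GVU (T U s).
  have PP : opens_preimage (mfun_cont f) (G V) `<=` opens_preimage (mfun_cont f) (G U).
    by move=> x /GVU.
  apply: inj; rewrite TE (pull_res GVU PP) TE.
  by rewrite !(res_comp _ _ (subset_trans (@FG V) VU)).
have jet x eps : @is_jet R Y q (f x) eps ->
    @is_jet R X q x (fun W s => eps (G W) (T W s)).
  move=> [eh er eu]; have Gx (W : opens X) : oset W x -> oset (G W) (f x).
    by move=> Wx; rewrite /G /= /preimage /= fg.
  split=> [W Wx|U V VU s Vx|W s Wx sx].
  - by apply: (@hom_comp _ _ _ _ (eps _)) => //; apply: eh; exact: Gx.
  - have GVU : G V `<=` G U by move=> z /VU.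
    by rewrite (T_res _ _ _ GVU) er //; exact: Gx.
  have [W' [W'W [W'x u]]] := eu _ _ (Gx W Wx) sx.
  have FW' : opens_preimage (mfun_cont f) W' `<=` opens_preimage (mfun_cont f) (G W).
    by move=> z /W'W.
  exists (opens_preimage (mfun_cont f) W'), (subset_trans FW' (@FG W)); split=> //.
  have := hom_unit (pull_hom f W') u.
  by rewrite (pull_res W'W FW') TE (res_comp _ _ (subset_trans FW' (@FG W))).
exists q; split=> [x _|U _ s s0].
  have [//|eps je] := ex (f x) _.
  by exists (fun W s => eps (G W) (T W s)); exact: jet.
have T0 : T U s = 0.
  apply: (sep (G U)) => // y eps Uy je.
  have je' : is_jet (f (g y)) eps by rewrite gf.
  exact: (s0 (g y) _ Uy (jet _ _ je')).
have := TE U s; rewrite T0 (hom0 (pull_hom f _)) => /esym/(congr1 (res (@GF U))).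
by rewrite (res_comp _ _ (@subset_refl _ U)) res_id (hom0 (res_hom _)).
Qed.

(** The form in which the cs manifold hypothesis is used; it passes from T to T x K/M by adjoining
    the two odd coordinates. *)
Definition locally_jets (X : superspace R) :=
  forall x : X, exists2 U : opens X, oset U x & has_jets U.

Lemma cs_manifold_jets (X : superspace R) : cs_manifold X -> locally_jets X.
Proof.
move=> cs x; have [p [q [U [V [Ux iso]]]]] := cs x; exists U => //.
apply: has_jets_from_subspace; apply: (isomorphic_has_jets iso).
exact/has_jets_to_subspace/model_has_jets.
Qed.

Lemma odd_line_jets (X : superspace R) :
  locally_jets X -> locally_jets (odd_line X).
Proof. by move=> jX x; have [U Ux jU] := jX x; exists U => //;
  exact: odd_line_has_jets. Qed.

End LocalJets.

(** * Entire functions *)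

Section Entire.
Variable R : realType.
Implicit Types (c : nat -> R) (F G : R -> R) (a r x K : R).

(** Domination by the series of K e^{r x}. This class contains the series of exp, cos and sin and is
    stable under termwise differentiation and under removal of initial terms. *)
Definition entire_coef c := exists K r, [/\ 0 <= K, 0 <= r &
  forall n, `|c n| <= K * exp_coeff r n].

Definition entire c x := limn (pseries c x).

Lemma entire_coef_cvg c x : entire_coef c -> cvgn (pseries c x).
Proof.
move=> [K [r [K0 r0 cn]]]; apply: normed_cvg.
apply: (@series_le_cvg _ _ (K *: exp_coeff (r * `|x|))).
- by move=> n; exact: normr_ge0.
- by move=> n; rewrite /= mulr_ge0 // exp_coeff_ge0 // mulr_ge0.
- move=> n /=; rewrite normrM normrX.
  apply: le_trans (ler_wpM2r (exprn_ge0 _ (normr_ge0 x)) (cn n)) _.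
  by rewrite -[leRHS]/(K * ((r * `|x|) ^+ n / n`!%:R))
    exprMn /exp_coeff /= -mulrA (mulrAC (r ^+ n)).
- by apply: is_cvg_seriesZ; exact: is_cvg_series_exp_coeff.
Qed.

Lemma entire_coef_diffs c : entire_coef c -> entire_coef (pseries_diffs c).
Proof.
move=> [K [r [K0 r0 cn]]]; exists (K * r), r; split=> // [|n]; first exact: mulr_ge0.
rewrite /pseries_diffs normrM ger0_norm //.
apply: le_trans (ler_wpM2l _ (cn n.+1)) _ => //.
rewrite /exp_coeff /= exprS factS natrM invfM.
rewrite le_eqVlt; apply/orP; left; apply/eqP.
by field; rewrite nat1r !pnatr_eq0 -lt0n fact_gt0.
Qed.

(** As n! is at most (N + n)!, the shift costs only a factor r^N in the constant. *)
Lemma entire_coef_shift c N : entire_coef c -> entire_coef (fun n => c (N + n)%N).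
Proof.
move=> [K [r [K0 r0 cn]]]; exists (K * r ^+ N), r; split=> // [|n].
  by rewrite mulr_ge0 // exprn_ge0.
apply: le_trans (cn _) _; rewrite /exp_coeff /= exprD -!mulrA ler_wpM2l //.
rewrite ler_wpM2l ?exprn_ge0 // ler_wpM2l ?exprn_ge0 //.
rewrite lef_pV2 ?posrE ?ltr0n ?fact_gt0 // ler_nat.
by rewrite dvdn_leq ?fact_gt0 // (fact_split (leq_addl N n)) dvdn_mulr.
Qed.

Lemma entire_derive c x : entire_coef c ->
  is_derive x 1 (entire c) (entire (pseries_diffs c) x).
Proof.
move=> ec; have ed := entire_coef_diffs ec; have edd := entire_coef_diffs ed.
apply: (@pseries_snd_diffs _ c (`|x| + 1)); try exact: entire_coef_cvg.
by rewrite [ltRHS]ger0_norm ?ltrDl // addr_ge0.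
Qed.

(** Taylor's formula with a remainder that is x^N times an entire function. This factor makes the
    remainder vanish once a nilpotent element is substituted for x. *)
Lemma entire_expand c N x : entire_coef c ->
  entire c x = \sum_(i < N) c i * x ^+ i + x ^+ N * entire (fun n => c (N + n)%N) x.
Proof.
move=> ec; elim: N => [|N IH].
  by rewrite big_ord0 add0r expr0 mul1r.
rewrite IH big_ord_recr /= -addrA; congr (_ + _).
have eN := entire_coef_shift N ec; have eN1 := entire_coef_shift N.+1 ec.
rewrite exprSr -mulrA (mulrC (c N)) -mulrDr; congr (_ * _).
set d := fun n => c (N + n)%N; rewrite -[c N]/(c N) -{1}(addn0 N) -/(d 0%N).
have cv : series (fun i => d i * x ^+ i) @ \oo --> entire d x.
  exact: entire_coef_cvg.
have cv1 := @entire_coef_cvg _ x eN1.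
apply: cvg_lim => //; rewrite -cvg_shiftS /=.
rewrite (_ : (fun _ => _) = (fun n => d 0%N + x * pseries (fun n => c (N.+1 + n)%N) x n)).
  by apply: cvgD; [exact: cvg_cst|apply: cvgMr; exact: cv1].
apply/funext => n; rewrite /pseries /series /= big_nat_recl //= expr0 mulr1.
congr (_ + _); rewrite mulr_sumr; apply: eq_bigr => i _.
by rewrite /d addSnnS exprS mulrCA.
Qed.

Lemma entire_coef_exp a : entire_coef (exp_coeff a).
Proof.
exists 1, `|a|; split=> // n; rewrite mul1r /exp_coeff /= normrM normfV normr_nat.
by rewrite normrX.
Qed.

Lemma entire_exp a x : expR (a * x) = entire (exp_coeff a) x.
Proof.
rewrite /expR /entire /pseries; congr (limn (series _)); apply/funext => n.
by rewrite /exp_coeff /= exprMn mulrAC.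
Qed.

Lemma entire_coef_cos a : entire_coef (cos_coeff a).
Proof.
exists 1, `|a|; split=> // n; rewrite mul1r /exp_coeff /= normrM normfV normr_nat.
rewrite ler_wpM2r ?invr_ge0 // !normrM normrX normr_nat.
by rewrite normrX normrN1 expr1n mulr1; case: odd; rewrite ?mul0r ?mul1r.
Qed.

Lemma entire_cos a x : cos (a * x) = entire (cos_coeff a) x.
Proof.
rewrite unlock /entire /pseries; congr (limn (series _)); apply/funext => n.
by rewrite /cos_coeff /= exprMn !mulrA mulrAC.
Qed.

Lemma entire_coef_sin a : entire_coef (sin_coeff a).
Proof.
exists 1, `|a|; split=> // n; rewrite mul1r /exp_coeff /= normrM normfV normr_nat.
rewrite ler_wpM2r ?invr_ge0 // !normrM normrX normr_nat.
by rewrite normrX normrN1 expr1n mulr1; case: odd; rewrite ?mul0r ?mul1r.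
Qed.

Lemma entire_sin a x : sin (a * x) = entire (sin_coeff a) x.
Proof.
rewrite unlock /entire /pseries; congr (limn (series _)); apply/funext => n.
by rewrite /sin_coeff /= exprMn !mulrA mulrAC.
Qed.

Lemma Ck_entire p k (U : set 'rV[R]_p) (g : 'rV[R]_p -> R) c :
  open U -> entire_coef c ->
  Ck k U g -> Ck k U (fun y => entire c (g y)).
Proof.
move=> oU ec; apply: (@Ck_comp _ _ _ _ _
  (fun F => exists2 c, entire_coef c & F = entire c)) => //.
  move=> _ [d ed ->]; exists (entire (pseries_diffs d)).
    by exists (pseries_diffs d) => //; exact: entire_coef_diffs.
  by move=> t; exact: entire_derive.
by exists c.
Qed.

End Entire.

(** * Values, jets and invertibility *)

Section Values.
Variables (R : realType) (X : superspace R).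

(** If the body differed from c, then f - c would be invertible near x by [jet_unit]. *)
Lemma jet_value (q : nat) (x : X) eps (f : global X) (c : R[i]) :
  @is_jet R X q x eps -> has_value f x c -> body (eps (full X) f) = c.
Proof.
move=> [eh _ eu] /has_valueP fc; have h := eh (full X) I.
apply/eqP; rewrite -subr_eq0; apply/negPn/negP => nz; apply: fc.
apply: eu => //.
by rewrite (homB h) (homB (@body_hom R q)) (hom_scal h) (hom_scal (@body_hom R q)).
Qed.

Hypothesis jX : locally_jets X.

Lemma has_value_unit_at (f : global X) (x : X) (c : R[i]) :
  c != 0 -> has_value f x c -> unit_at f x.
Proof.
move=> c0 fc; have [U Ux [q [/(_ x Ux)[eps je] _]]] := jX x.
by apply: (jet_unit je) => //; rewrite (jet_value je fc).
Qed.

(** Jets separate sections over the members of an open cover, and the sheaf axiom makes this global.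
    The number q may vary between members. *)
Lemma eq_global_jets (f g : global X) :
  (forall q (x : X) eps, @is_jet R X q x eps -> eps (full X) f = eps (full X) g) ->
  f = g.
Proof.
move=> fg; pose U (x : X) := s2val (cid2 (jX x)).
have US (x : X) : U x `<=` full X by [].
have Ux (x : X) : oset (U x) x by rewrite /U; case: cid2.
have jU (x : X) : has_jets (U x) by rewrite /U; case: cid2.
apply: (@sheaf_sep R X X (full X) U US) => [x _|x]; first by exists x.
apply/eqP; rewrite -subr_eq0 -(homB (res_hom _)); apply/eqP.
have [q [_ sep]] := jU x; apply: (sep (U x)) => // y eps Uy je.
rewrite (jet_res je) // (homB (jet_hom je _)) //.
by rewrite (fg q y eps je) subrr.
Qed.

End Values.

(** Inverses are unique, so the local ones agree on overlaps and glue. *)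
Lemma unit_at_unit (R : realType) (X : superspace R) (f : global X) :
  (forall x, unit_at f x) -> is_unit f.
Proof.
move=> uf; pose W x := projT1 (cid (uf x)).
have WS x : W x `<=` full X by [].
have Wx x : oset (W x) x by rewrite /W; case: cid => V [VU []].
have uW x : is_unit (res (WS x) f).
  move: (WS x); rewrite /W; case: cid => V [VU [Vx u]] /= VU'.
  by rewrite (Prop_irrelevance VU' VU).
pose g x := projT1 (cid (uW x)).
have gE x : res (WS x) f * g x = 1 /\ g x * res (WS x) f = 1 := projT2 (cid (uW x)).
case: (@sheaf_glue R X X (full X) W WS _ g) => [x _|x y V Vx Vy|h hE].
- by exists x.
- have [f1 _] := gE y; have [_ g1] := gE x.
  move/(congr1 (res Vy)): f1; move/(congr1 (res Vx)): g1.
  rewrite !(homM (res_hom _)) !(hom1 (res_hom _)).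
  rewrite !(res_comp _ _ (fun z _ => I : oset (full X) z)) => g1 f1.
  by rewrite -[LHS]mulr1 -f1 mulrA g1 mul1r.
exists h; split; apply: (@sheaf_sep R X X (full X) W WS) => [x _|x];
  by [exists x|rewrite (homM (res_hom _)) hE (hom1 (res_hom _)); case: (gE x)].
Qed.

Section Pull.
Variables (R : realType) (X Y : superspace R) (h : morphism X Y).

Lemma pull_global_hom : superalg_hom (pull_global h).
Proof. exact: hom_comp (res_hom _) (pull_hom h (full Y)). Qed.

Lemma unit_at_pull (f : global Y) (x : X) :
  unit_at (pull_global h f) x -> unit_at f (h x).
Proof.
move=> [W [WX [Wx u]]]; apply: (@pull_local _ _ _ h (full Y)).
have W' : W `<=` opens_preimage (mfun_cont h) (full Y) by [].
by exists W, W'; split=> //; move: u; rewrite /pull_global (res_comp _ _ W').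
Qed.

End Pull.

(** If the pullback of F - F(h(x)) were invertible near x, then by locality of h so would be F -
    F(h(x)) near h(x), where it has a zero. *)
Lemma pull_smooth_value (R : realType) p (X : superspace R)
    (h : morphism X (smooth_space R p)) (F : global (smooth_space R p)) (x : X) :
  has_value (pull_global h F) x ((F : smooth_fun _) (h x)).
Proof.
apply/has_valueP; rewrite -(hom_scal (pull_global_hom h)) -(homB (pull_global_hom h)).
move=> /unit_at_pull[W [WU [Wx u]]].
have [g [g1 _]] := hom_unit (smooth_eval_hom Wx) u.
have E := @smooth_eval_hom R p (full _) (h x) I.
move: g1; rewrite [X in X * _](_ : _ = 0).
  by rewrite mul0r => /esym/eqP; rewrite oner_eq0.
rewrite [LHS]mk_smoothE //.
by rewrite [LHS](homB E) (hom_scal E) subrr.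
Qed.

(** * Morphisms from smooth functions to Grassmann algebras *)

Section Complex.
Variable R : realType.

Lemma cexpD (z w : R[i]) : cexp (z + w) = cexp z * cexp w.
Proof.
case: z w => a b [c d]; rewrite /cexp /= expRD cosD sinD.
by apply/eqP; rewrite eq_complex /=; apply/andP; split; apply/eqP; ring.
Qed.

Lemma cexp_real (a : R) : cexp a%:C = (expR a)%:C.
Proof. by rewrite /cexp /= cos0 sin0 mulr1 mulr0. Qed.

Lemma cexp_scale (s : R) (z : R[i]) : cexp (s%:C * z) =
  (expR (complex.Re z * s))%:C *
  ((cos (complex.Im z * s))%:C + 'i * (sin (complex.Im z * s))%:C).
Proof.
case: z => a b; rewrite /cexp /=.
apply/eqP; rewrite eq_complex /= !mul0r !subr0 !addr0 !mul1r !(mulrC s).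
by rewrite ?(mulr0, subr0, addr0, add0r, mul0r) !eqxx.
Qed.

End Complex.

Section Characters.
Variables (R : realType) (p : nat).
Notation Sm := (smooth_fun (full 'rV[R]_p)).

Lemma smooth_entire (c : nat -> R) (j : 'I_p) (t : 'rV[R]_p) : entire_coef c ->
  smooth (full 'rV[R]_p) (fun x => (entire c (x 0 j - t 0 j))%:C).
Proof.
move=> ec k; split; last exact: Ck_cst.
apply: Ck_entire openT ec _.
by apply: Ck_add openT (@Ck_coord _ _ _ _ _) (Ck_cst _ _ _).
Qed.

Lemma smooth_shifted_coord (j : 'I_p) (t : 'rV[R]_p) :
  smooth (full 'rV[R]_p) (fun x => (x 0 j - t 0 j)%:C).
Proof.
move=> k; split; last exact: Ck_cst.
by apply: Ck_add openT (@Ck_coord _ _ _ _ _) (Ck_cst _ _ _).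
Qed.

Definition entire_fun c (ec : entire_coef c) j t : Sm := mk_smooth (smooth_entire j t ec).
Definition shifted_coord j t : Sm := mk_smooth (smooth_shifted_coord j t).

Lemma entire_fun_expand c (ec : entire_coef c) N j t :
  entire_fun ec j t =
    \sum_(i < N) scal (c i)%:C * shifted_coord j t ^+ i +
    shifted_coord j t ^+ N * entire_fun (entire_coef_shift N ec) j t.
Proof.
apply: smooth_fun_ext => x xT; have E := smooth_eval_hom xT.
rewrite [LHS]mk_smoothE // (entire_expand N _ ec).
rewrite [RHS](homD E) (hom_sum E) (homM E) (homX E) ![shifted_coord _ _ _]mk_smoothE //.
rewrite [entire_fun _ _ _ _]mk_smoothE // rmorphD rmorphM rmorphXn rmorph_sum.
congr (_ + _); apply: eq_bigr => i _.
by rewrite (homM E) (homX E) (hom_scal E) mk_smoothE // rmorphM rmorphXn.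
Qed.

Variables (q : nat) (chi : Sm -> grassmann R q) (t : 'rV[R]_p).
Hypotheses (ch : superalg_hom chi) (chit : forall F : Sm, body (chi F) = F t).

Lemma char_shifted_coord_body j : body (chi (shifted_coord j t)) = 0.
Proof. by rewrite chit mk_smoothE // subrr. Qed.

Lemma char_shifted_coord_even j : is_even (chi (shifted_coord j t)).
Proof. exact: hom_even. Qed.

(* The order [q.+2] exceeds the nilpotency order [q.+1], so that the linear
   coefficient is present even when [q = 0]. *)
Lemma char_entire_fun c (ec : entire_coef c) j :
  chi (entire_fun ec j t) =
    \sum_(i < q.+2) scal (c i)%:C * chi (shifted_coord j t) ^+ i.
Proof.
rewrite (entire_fun_expand ec q.+2) (homD ch) (homM ch) (homX ch) exprS.
rewrite (grassmann_nilp (char_shifted_coord_even j) (char_shifted_coord_body j)).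
rewrite mulr0 mul0r addr0 (hom_sum ch); apply: eq_bigr => i _.
by rewrite (homM ch) (homX ch) (hom_scal ch).
Qed.

End Characters.

Section CharactersEq.
Variables (R : realType).

(** The difference of the two sums is (W - W') [U], with [T i] the quotient of W^i - W'^i by W - W'.
    As W and W' have body zero, the body of [U] is the linear coefficient, so [U] is a unit. *)
Lemma grassmann_eq_of_series q (W W' : grassmann R q) (c : nat -> R[i]) n :
  is_even W -> body W = 0 -> body W' = 0 -> c 1%N != 0 ->
  \sum_(i < n.+2) scal (c i) * W ^+ i = \sum_(i < n.+2) scal (c i) * W' ^+ i ->
  W = W'.
Proof.
move=> eW bW bW' c1 /eqP; rewrite -subr_eq0 -sumrB => /eqP.
have cWW' : GRing.comm W W' by exact: even_central.
pose T (i : nat) := \sum_(j < i) W ^+ (i.-1 - j) * W' ^+ j.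
under eq_bigr do rewrite -mulrBr subrXX_comm // -/(T _) mulrA (scalC _ (W - W')) -mulrA.
rewrite -mulr_sumr.
set U := \sum_(i < _) _ => WU0.
have bh := @body_hom R q.
have /body_unit[V [UV _]] : body U != 0.
  rewrite (_ : body U = c 1%N) // (hom_sum bh) !big_ord_recl big1 => [|i _].
    rewrite /T /= big_ord0 mulr0 (hom0 bh) add0r addr0 big_ord_recl big_ord0 addr0.
    by rewrite !expr0 !mulr1 (hom_scal bh).
  rewrite (homM bh) (hom_sum bh) big1 ?mulr0 // => j _.
  rewrite (homM bh) !(homX bh) bW bW' !expr0n /=.
  by case: j => [[|j] /= _]; rewrite ?mulr0 ?mul0r.
by apply/eqP; rewrite -subr_eq0 -[_ - _]mulr1 -UV mulrA WU0 mul0r.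
Qed.

End CharactersEq.

Lemma scal_mulI (R : realType) (A : superAlgType R) (c : R[i]) (x y : A) :
  c != 0 -> scal c * x = scal c * y -> x = y.
Proof.
move=> c0 e; rewrite -[x]mul1r -[y]mul1r -(scal1 (s := A)) -(mulVf c0) scalM.
by rewrite -!mulrA e.
Qed.

(** * Exponentials of linear forms under algebra morphisms *)

Section ExpForm.
Variable R : realType.
Notation C := R[i].
Notation Sm := (smooth_fun (full 'rV[R]_2)).
Implicit Types mu nu phi : {scalar 'rV[C]_2}.

Lemma exp_formE mu (x : 'rV[R]_2) :
  (exp_form mu : Sm) x = cexp (mu (complexify x)).
Proof. exact: mk_smoothE. Qed.

Lemma exp_formD mu nu phi : (forall a, phi a = mu a + nu a) ->
  exp_form phi = exp_form mu * exp_form nu.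
Proof.
move=> E; apply: smooth_fun_ext => x _.
by rewrite exp_formE [RHS]mk_smoothE // !exp_formE E cexpD.
Qed.

Lemma scalar_complexify mu (x : 'rV[R]_2) :
  mu (complexify x) = (x 0 0)%:C * mu (delta_mx 0 0) + (x 0 1)%:C * mu (delta_mx 0 1).
Proof.
rewrite {1}(row_sum_delta (complexify x)) linear_sum !big_ord_recl big_ord0 addr0.
rewrite !linearZ /= !mxE.
by have -> : lift ord0 ord0 = 1 :> 'I_2 by apply: val_inj.
Qed.

Lemma exp_form_coord nu j m (t : 'rV[R]_2) :
  (forall a : 'rV[C]_2, nu a = m%:C * a 0 j) ->
  exp_form nu = scal (expR (m * t 0 j))%:C * entire_fun (entire_coef_exp m) j t.
Proof.
move=> nuE; apply: smooth_fun_ext => x xT.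
have E := smooth_eval_hom xT.
rewrite exp_formE [RHS](homM E) (hom_scal E) [entire_fun _ _ _ _]mk_smoothE //.
rewrite -entire_exp nuE mxE -rmorphM cexp_real -rmorphM -expRD -mulrDr /=.
by congr ((expR (m * _))%:C); rewrite addrCA subrr addr0.
Qed.

(** Reduces e^mu to entire functions of a single real coordinate centred at t, which
    [char_entire_fun] evaluates. By Euler's formula, a complex coefficient a + i b of mu contributes
    an exponential, a cosine and a sine. *)
Lemma exp_form_expand mu (t : 'rV[R]_2) :
  let a j := complex.Re (mu (delta_mx 0 j)) in
  let b j := complex.Im (mu (delta_mx 0 j)) in
  let F j := entire_fun (entire_coef_exp (a j)) j t *
    (entire_fun (entire_coef_cos (b j)) j t +
     scal 'i * entire_fun (entire_coef_sin (b j)) j t) in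
  exp_form mu = scal (cexp (mu (complexify t))) * (F 0 * F 1).
Proof.
move=> a b F; apply: smooth_fun_ext => x xT.
have E := smooth_eval_hom xT.
have FE j : F j x = cexp ((x 0 j - t 0 j)%:C * mu (delta_mx 0 j)).
  rewrite cexp_scale -/(a j) -/(b j) entire_exp entire_cos entire_sin /F.
  rewrite [LHS](homM E) (homD E) (homM E) (hom_scal E).
  by rewrite ![entire_fun _ _ _ _]mk_smoothE.
rewrite exp_formE [RHS](homM E) (homM E) (hom_scal E) !FE -!cexpD; congr cexp.
rewrite !scalar_complexify !rmorphB /=; ring.
Qed.

Variables (q : nat) (chi chi' : Sm -> grassmann R q) (t t' : 'rV[R]_2).
Hypotheses (ch : superalg_hom chi) (chit : forall F : Sm, body (chi F) = F t).
Hypotheses (ch' : superalg_hom chi') (chit' : forall F : Sm, body (chi' F) = F t').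

(** One real exponential in each coordinate suffices: its body determines the base point, and its
    nilpotent part determines the image of the shifted coordinate by [grassmann_eq_of_series]. All
    entire functions of the coordinates follow. *)
Lemma char_exp_form_eq (nu : 'I_2 -> {scalar 'rV[C]_2}) (m : 'I_2 -> R) :
  (forall j, m j != 0) -> (forall j (a : 'rV[C]_2), nu j a = (m j)%:C * a 0 j) ->
  (forall j, chi (exp_form (nu j)) = chi' (exp_form (nu j))) ->
  forall mu, chi (exp_form mu) = chi' (exp_form mu).
Proof.
move=> m0 nuE nuchi mu.
(* The bodies are real exponentials of nonzero multiples of the coordinates, and the real
   exponential is injective. *)
have tt' : t = t'.
  apply/rowP => j; have := congr1 (@body R q) (nuchi j).
  rewrite chit chit' !exp_formE !nuE !mxE -!rmorphM !cexp_real => /complexI/expR_inj.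
  exact: mulfI.
subst t'.
have WW' j : chi (shifted_coord j t) = chi' (shifted_coord j t).
  have FE : chi (entire_fun (entire_coef_exp (m j)) j t) =
            chi' (entire_fun (entire_coef_exp (m j)) j t).
    have := nuchi j; rewrite (exp_form_coord t (nuE j)).
    rewrite (homM ch) (homM ch') (hom_scal ch) (hom_scal ch').
    have z0 : (expR (m j * t 0 j))%:C != 0 :> C by rewrite fmorph_eq0 gt_eqF ?expR_gt0.
    exact: scal_mulI.
  rewrite (char_entire_fun ch chit) (char_entire_fun ch' chit') in FE.
  apply: (grassmann_eq_of_series (c := fun i => (exp_coeff (m j) i)%:C)) FE.
  - exact: (char_shifted_coord_even _ ch).
  - exact: (char_shifted_coord_body chit).
  - exact: (char_shifted_coord_body chit').
  by rewrite /exp_coeff /= expr1 divr1 fmorph_eq0.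
have FF c (ec : entire_coef c) j : chi (entire_fun ec j t) = chi' (entire_fun ec j t).
  by rewrite (char_entire_fun ch chit) (char_entire_fun ch' chit') WW'.
rewrite (exp_form_expand mu t).
rewrite !(homM ch) !(homD ch) !(homM ch) !(hom_scal ch).
by rewrite !(homM ch') !(homD ch') !(homM ch') !(hom_scal ch') !FF.
Qed.

End ExpForm.

(** * Points of the Cartan subspace *)

(** The squares are the pullbacks of e^{-2 x_1} and e^{2 x_2}; jets reduce the claim to
    [char_exp_form_eq] with the multipliers -2 and 2. *)
Lemma exp_at_unique (R : realType) (X : superspace R) (H H' : morphism X (affine_aR R)) :
  locally_jets X ->
  exp_at (\- coordinate 0) H * exp_at (\- coordinate 0) H =
  exp_at (\- coordinate 0) H' * exp_at (\- coordinate 0) H' ->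
  exp_at (coordinate 1) H * exp_at (coordinate 1) H =
  exp_at (coordinate 1) H' * exp_at (coordinate 1) H' ->
  forall mu, exp_at mu H = exp_at mu H'.
Proof.
move=> jX e0 e1 mu; apply: (eq_global_jets jX) => q x eps je.
pose nu0 : {scalar 'rV[R[i]]_2} := (\- coordinate 0) \+ (\- coordinate 0).
pose nu1 : {scalar 'rV[R[i]]_2} := coordinate 1 \+ coordinate 1.
have eh := jet_hom je (I : oset (full X) x).
have hH := hom_comp eh (pull_global_hom H).
have hH' := hom_comp eh (pull_global_hom H').
apply: (char_exp_form_eq hH (t := H x) _ hH' (t' := H' x) _
  (nu := fun j => if j == 0 then nu0 else nu1)
  (m := fun j => if j == 0 then - 2 else 2)).
- by move=> F; have := jet_value je (@pull_smooth_value R 2 X H F x).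
- by move=> F; have := jet_value je (@pull_smooth_value R 2 X H' F x).
- by move=> j; case: ifP; rewrite ?oppr_eq0 pnatr_eq0.
- move=> j a; have j01 : j = if j == 0 then 0 else 1.
    by apply: val_inj; case: j => [[|[|]]].
  move: j01; case: ifP => _ -> /=; rewrite /coordinate
    ?(rmorphN, rmorph_nat) -?opprD -mulr2n.
    by rewrite mulNr mulr_natl.
  by rewrite mulr_natl.
move=> j /=; case: ifP => _; congr (eps _ _).
  by rewrite (@exp_formD _ (\- coordinate 0) (\- coordinate 0)) //
    !(homM (pull_global_hom _)).
by rewrite (@exp_formD _ (coordinate 1) (coordinate 1)) // !(homM (pull_global_hom _)).
Qed.

(** * Partial derivatives as derivations of smooth functions *)

Section Partials.
Variables (R : realType) (p : nat).
Implicit Types (V : opens 'rV[R]_p) (j : 'I_p).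

Lemma derive_line (f : 'rV[R]_p -> R) (x v : 'rV[R]_p) :
  'D_v f x = 'D_1 (fun s : R => f (s *: v + x)) 0.
Proof.
rewrite /derive; set a := fun _ => _; set b := fun _ => _; suff -> : b = a by [].
apply/funext => s; rewrite /a /b /=.
by rewrite addr0 scale0r add0r /GRing.scale /= mulr1.
Qed.

Lemma partial_eq j (U : set 'rV[R]_p) (f g : 'rV[R]_p -> R) x : open U -> U x ->
  (forall y, U y -> f y = g y) -> partial j f x = partial j g x.
Proof.
move=> oU Ux fg; apply: near_eq_derive.
by apply: filterS (open_nbhs_nbhs (conj oU Ux)) => y /fg.
Qed.

Definition cpartial j (f : 'rV[R]_p -> R[i]) : 'rV[R]_p -> R[i] :=
  fun x => partial j (fun y => complex.Re (f y)) x
    +i* partial j (fun y => complex.Im (f y)) x.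

Lemma smooth_cpartial j (U : set 'rV[R]_p) (f : 'rV[R]_p -> R[i]) :
  smooth U f -> smooth U (cpartial j f).
Proof.
move=> sf k; have [[_ rf] [_ mf]] := sf k.+1.
by split; [have [] := rf j|have [] := mf j].
Qed.

Lemma smooth_derivable j (U : set 'rV[R]_p) (f : 'rV[R]_p -> R[i]) x :
  smooth U f -> U x ->
  derivable (fun y => complex.Re (f y)) x (delta_mx 0 j) /\
  derivable (fun y => complex.Im (f y)) x (delta_mx 0 j).
Proof.
move=> sf Ux; have [[_ rf] [_ mf]] := sf 1%N.
by split; [have [h _] := rf j|have [h _] := mf j]; exact: h.
Qed.

Definition smooth_partial j V (f : smooth_fun V) : smooth_fun V :=
  mk_smooth (smooth_cpartial j (smooth_valP f)).

Lemma smooth_partial_eq j V (f : smooth_fun V) (F : 'rV[R]_p -> R[i]) x :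
  oset V x -> (forall y, oset V y -> f y = F y) ->
  smooth_partial j f x = cpartial j F x.
Proof.
move=> Vx fF; rewrite mk_smoothE // /cpartial.
by congr (_ +i* _); apply: (partial_eq j (oset_open V) Vx) => y /fF ->.
Qed.

Lemma smooth_partialD j V : {morph @smooth_partial j V : f g / f + g}.
Proof.
move=> f g; apply: smooth_fun_ext => x Vx.
have E := smooth_eval_hom Vx.
rewrite [RHS](homD E) (smooth_partial_eq (F := fun y => f y + g y) j Vx); last first.
  by move=> y Vy; exact: homD (smooth_eval_hom Vy) _ _.
rewrite !mk_smoothE //.
have [rf mf] := smooth_derivable j (smooth_valP f) Vx.
have [rg mg] := smooth_derivable j (smooth_valP g) Vx.
rewrite /cpartial /partial.
have -> : (fun y => complex.Re (f y + g y)) =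
    (fun y => complex.Re (f y)) + (fun y => complex.Re (g y)).
  by apply/funext => y; rewrite ReD.
have -> : (fun y => complex.Im (f y + g y)) =
    (fun y => complex.Im (f y)) + (fun y => complex.Im (g y)).
  by apply/funext => y; rewrite ImD.
by rewrite (deriveD rf rg) (deriveD mf mg).
Qed.

Section DeriveMul.
Variables (f1 f2 g1 g2 : 'rV[R]_p -> R) (x v : 'rV[R]_p).
Hypotheses (df1 : derivable f1 x v) (df2 : derivable f2 x v).
Hypotheses (dg1 : derivable g1 x v) (dg2 : derivable g2 x v).

Lemma derive_mulD : 'D_v (f1 * g1 + f2 * g2) x =
  f1 x * 'D_v g1 x + g1 x * 'D_v f1 x + (f2 x * 'D_v g2 x + g2 x * 'D_v f2 x).
Proof.
have D1 := is_deriveM (derivableP df1) (derivableP dg1).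
have D2 := is_deriveM (derivableP df2) (derivableP dg2).
by have [_ ->] := is_deriveD D1 D2.
Qed.

Lemma derive_mulB : 'D_v (f1 * g1 - f2 * g2) x =
  f1 x * 'D_v g1 x + g1 x * 'D_v f1 x - (f2 x * 'D_v g2 x + g2 x * 'D_v f2 x).
Proof.
have D1 := is_deriveM (derivableP df1) (derivableP dg1).
have D2 := is_deriveM (derivableP df2) (derivableP dg2).
by have [_ ->] := is_deriveB D1 D2.
Qed.

End DeriveMul.

Lemma smooth_partialM j V (f g : smooth_fun V) :
  smooth_partial j (f * g) = f * smooth_partial j g + smooth_partial j f * g.
Proof.
apply: smooth_fun_ext => x Vx.
have E := smooth_eval_hom Vx.
rewrite [RHS](homD E) !(homM E)
  (smooth_partial_eq (F := fun y => f y * g y) j Vx); last first.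
  by move=> y Vy; exact: homM (smooth_eval_hom Vy) _ _.
rewrite !mk_smoothE //.
have [rf mf] := smooth_derivable j (smooth_valP f) Vx.
have [rg mg] := smooth_derivable j (smooth_valP g) Vx.
rewrite /cpartial /partial.
have -> : (fun y => complex.Re (f y * g y)) =
    (fun y => complex.Re (f y)) * (fun y => complex.Re (g y)) -
    (fun y => complex.Im (f y)) * (fun y => complex.Im (g y)).
  by apply/funext => y; rewrite Defs.ReM.
have -> : (fun y => complex.Im (f y * g y)) =
    (fun y => complex.Re (f y)) * (fun y => complex.Im (g y)) +
    (fun y => complex.Im (f y)) * (fun y => complex.Re (g y)).
  by apply/funext => y; rewrite Defs.ImM.
rewrite (derive_mulB rf mf rg mg) (derive_mulD rf mf mg rg).
case: (f x) => f1 f2; case: (g x) => g1 g2.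
by apply/eqP; rewrite eq_complex /=; apply/andP; split; apply/eqP; ring.
Qed.

Lemma smooth_partial_scal j V (c : R[i]) : smooth_partial j (scal c : smooth_fun V) = 0.
Proof.
apply: smooth_fun_ext => x Vx.
rewrite (smooth_partial_eq (F := fun=> c) j Vx) => [|y Vy]; last exact: mk_smoothE.
by rewrite /cpartial /partial !derive_cst [RHS]mk_smoothE.
Qed.

Lemma smooth_partial_res j (U V : opens 'rV[R]_p) (VU : V `<=` U) (f : smooth_fun U) :
  smooth_partial j (smooth_res VU f) = smooth_res VU (smooth_partial j f).
Proof.
apply: smooth_fun_ext => x Vx; have Ux := VU x Vx.
rewrite (smooth_partial_eq (F := f) j Vx) => [|y Vy]; last exact: mk_smoothE.
by rewrite [RHS]mk_smoothE // mk_smoothE.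
Qed.

End Partials.

Section KMEvenHom.
Variables (R : realType) (A B : superAlgType R) (f : A -> B) (D : A -> A) (e : B).

(** Adding e xi eta times f after a derivation keeps f multiplicative: the Leibniz rule gives the
    first-order term, and there is no second one because xi eta squares to zero. *)
Lemma KM_even_hom : superalg_hom f -> (forall x : A, is_even x) -> is_even e ->
  {morph D : x y / x + y} -> (forall x y, D (x * y) = x * D y + D x * y) ->
  (forall c : R[i], D (scal c) = 0) ->
  superalg_hom ((fun x => KM_even (f x) (e * f (D x))) : A -> adjoin (adjoin B)).
Proof.
move=> fh ev ee DD DM Ds; split=> [x y|x y|x|c].
- by rewrite KM_evenD DD !(homD fh) mulrDr.
- rewrite KM_evenM; last exact/(hom_even fh)/ev.
  rewrite DM (homD fh) !(homM fh) mulrDr; congr (KM_even _ (_ + _)).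
    by rewrite !mulrA (even_central _ (f x) ee).
  by rewrite mulrA.
- rewrite (KM_even_even (hom_even fh (ev x))) ?ev //.
  by apply: evenM => //; exact/(hom_even fh)/ev.
- by rewrite Ds (hom0 fh) mulr0 (hom_scal fh).
Qed.

End KMEvenHom.

(** * Moving a point of the Cartan subspace along h^+ *)

Section Deformation.
Variable R : realType.
Notation Sm := (smooth_fun (full 'rV[R]_2)).

Lemma is_derive_affine (f f' : R -> R) (a A : R) :
  (forall t : R, is_derive t 1 f (f' t)) ->
  is_derive (0 : R) 1 (fun s => f (s * a + A)) (f' A * a).
Proof.
move=> df.
have da : is_derive (0 : R) 1 (fun s : R => s * a + A) a.
  apply: (is_derive_eq (is_deriveD (is_deriveM (is_derive_id (0 : R) 1)
    (is_derive_cst a (0 : R) 1)) (is_derive_cst A (0 : R) 1))).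
  by rewrite /GRing.scale /= mulr0 add0r mulr1 addr0.
have d0 : is_derive (0 * a + A) 1 f (f' A) by rewrite mul0r add0r.
exact: (@is_derive1_comp _ f (fun s : R => s * a + A) 0 _ _ d0 da).
Qed.

Lemma smooth_partial_exp_form (mu : {scalar 'rV[R[i]]_2}) j :
  smooth_partial j (exp_form mu : Sm) = scal (mu (delta_mx 0 j)) * exp_form mu.
Proof.
apply: smooth_fun_ext => x xT; have E := smooth_eval_hom xT.
rewrite (smooth_partial_eq j xT (fun y _ => exp_formE mu y)).
rewrite [RHS](homM E) (hom_scal E) exp_formE /cpartial /partial !derive_line.
have L (s : R) : mu (complexify (s *: delta_mx 0 j + x))
    = s%:C * mu (delta_mx 0 j) + mu (complexify x).
  have -> : complexify (s *: delta_mx 0 j + x) = s%:C *: delta_mx 0 j + complexify x.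
    by apply/matrixP => k l; rewrite !mxE rmorphD rmorphM rmorph_nat.
  by rewrite linearD linearZ.
under eq_fun do rewrite L.
under [X in _ +i* 'D__ X _]eq_fun do rewrite L.
case: (mu (delta_mx 0 j)) => a b; case: (mu (complexify x)) => A B.
rewrite /cexp /=.
have -> : (fun s : R => expR (s * a - 0 * b + A) * cos (s * b + 0 * a + B)) =
    (fun s => expR (s * a + A)) * (fun s => cos (s * b + B)).
  by apply/funext => s; rewrite !mul0r subr0 addr0.
have -> : (fun s : R => expR (s * a - 0 * b + A) * sin (s * b + 0 * a + B)) =
    (fun s => expR (s * a + A)) * (fun s => sin (s * b + B)).
  by apply/funext => s; rewrite !mul0r subr0 addr0.
have dE := is_derive_affine a A (fun t => is_derive_expR t).
have dC := is_derive_affine b B (fun t => is_derive_cos t).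
have dS := is_derive_affine b B (fun t => is_derive_sin t).
have [_ ->] := is_deriveM dE dC; have [_ ->] := is_deriveM dE dS.
rewrite /GRing.scale /= !mul0r !add0r.
by apply/eqP; rewrite eq_complex /=; apply/andP; split; apply/eqP; ring.
Qed.

Variables (T : superspace R) (h : morphism T (affine_aR R)) (e : global T).
Hypothesis ee : is_even e.

(** The derivative in the direction h^+, both of whose coordinates are 1. *)
Definition euler (V : opens 'rV[R]_2) (f : smooth_fun V) : smooth_fun V :=
  smooth_partial 0 f + smooth_partial 1 f.

Lemma euler_res (V W : opens 'rV[R]_2) (WV : W `<=` V) (f : smooth_fun V) :
  euler (smooth_res WV f) = smooth_res WV (euler f).
Proof.
by rewrite /euler !smooth_partial_res -(homD (@res_hom R (smooth_space R 2) _ _ WV)).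
Qed.

Lemma euler_exp_form mu :
  euler (exp_form mu : Sm) = scal (mu (hplus R)) * exp_form mu.
Proof.
rewrite /euler !smooth_partial_exp_form -mulrDl -scalD -linearD.
congr (scal (mu _) * _); apply/matrixP => i j; rewrite !mxE ord1 /=.
by case: j => [[|[|]]] //= *; rewrite ?addr0 ?add0r.
Qed.

(** The Taylor expansion of f at h + e xi eta h^+, exact at first order. *)
Definition deform_pull (V : opens (affine_aR R)) (f : sec V) :
    @sec R (times_KM T) (opens_preimage (mfun_cont h) V) :=
  KM_even (pull h V f)
    (res (fun _ _ => I : oset (full T) _) e * pull h V (euler f)).

Lemma deform_pull_hom V : superalg_hom (@deform_pull V).
Proof.
apply: (@KM_even_hom R _ _ (pull h V) (@euler V)).
- exact: pull_hom.
- by [].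
- exact: (hom_even (res_hom _) ee).
- by move=> f g; rewrite /euler !smooth_partialD addrACA.
- move=> f g; rewrite /euler !smooth_partialM mulrDr mulrDl addrACA.
  by [].
- by move=> c; rewrite /euler !smooth_partial_scal addr0.
Qed.

Lemma deform_pull_res (V W : opens (affine_aR R)) (WV : W `<=` V)
    (WV' : opens_preimage (mfun_cont h) W `<=` opens_preimage (mfun_cont h) V)
    (f : sec V) :
  deform_pull (res WV f) = @res R (times_KM T) _ _ WV' (deform_pull f).
Proof.
have r0 := hom0 (res_hom WV').
rewrite /deform_pull /KM_even; congr pair; congr pair => //=.
  by rewrite (pull_res WV WV').
rewrite (homM (res_hom _)) (res_comp _ _ (fun _ _ => I : oset (full T) _)).
rewrite -(pull_res WV WV'); congr (_ * pull h W _).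
exact: euler_res.
Qed.

(** The coefficient free of xi and eta of a unit is a unit, and this coefficient is the pullback
    under h. *)
Lemma deform_pull_local (V : opens (affine_aR R)) (f : sec V) (x : times_KM T) :
  (exists (W : opens (times_KM T)) (WV : W `<=` opens_preimage (mfun_cont h) V),
     oset W x /\ is_unit (res WV (deform_pull f))) ->
  exists (W : opens (affine_aR R)) (WV : W `<=` V), oset W (h x) /\ is_unit (res WV f).
Proof.
move=> [W [WV [Wx u]]]; apply: (@pull_local _ _ _ h V f x).
by exists W, WV; split=> //; exact: adjoin_unitW (adjoin_unitW u).
Qed.

(* the point h + e xi eta h^+ of A(a_R) *)
Definition deform : morphism (times_KM T) (affine_aR R) :=
  @Morphism R (times_KM T) (affine_aR R) h (mfun_cont h)
    deform_pull deform_pull_hom deform_pull_res deform_pull_local.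

Lemma exp_at_deform mu :
  exp_at mu deform =
  KM_even (exp_at mu h) (scal (mu (hplus R)) * (e * exp_at mu h)).
Proof.
rewrite /exp_at /pull_global /= /deform_pull euler_exp_form.
have rh (U V : opens T) (VU : V `<=` U) := res_hom VU.
congr pair; congr pair; rewrite /= ?(hom0 (rh _ _ _)) //.
rewrite (homM (rh _ _ _)) (res_comp _ _ (fun _ _ => I : oset (full T) _)) res_id.
rewrite (homM (pull_hom h _)) (homM (rh _ _ _)) (hom_scal (pull_hom h _)).
by rewrite (hom_scal (rh _ _ _)) !mulrA (scalC _ e).
Qed.

End Deformation.

Section ExpAt.
Variables (R : realType) (X : superspace R) (h : morphism X (affine_aR R)).
Implicit Types mu nu phi : {scalar 'rV[R[i]]_2}.

Lemma exp_at_even mu : is_even (exp_at mu h).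
Proof. exact: (hom_even (pull_global_hom h) (erefl _)). Qed.

Lemma exp_atD mu nu phi : (forall a, phi a = mu a + nu a) ->
  exp_at phi h = exp_at mu h * exp_at nu h.
Proof. by move=> E; rewrite /exp_at (exp_formD E) (homM (pull_global_hom h)). Qed.

Lemma exp_atN mu : exp_at mu h * exp_at (\- mu) h = 1.
Proof.
rewrite -(homM (pull_global_hom h)) -(hom1 (pull_global_hom h)); congr (pull_global _ _).
apply: smooth_fun_ext => x xT; rewrite (homM (smooth_eval_hom xT)) !exp_formE.
by rewrite [RHS](hom1 (smooth_eval_hom xT)) -cexpD /= subrr
  -(rmorph0 (real_complex R)) cexp_real expR0.
Qed.

Lemma exp_at_value mu x : has_value (exp_at mu h) x (cexp (mu (complexify (h x)))).
Proof. by have := @pull_smooth_value R 2 X h (exp_form mu) x; rewrite exp_formE. Qed.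

(** The content is that 0 is not invertible near x, which the locality of h guarantees. *)
Lemma has_value1 x : has_value (1 : global X) x 1.
Proof.
have := @pull_smooth_value R 2 X h 1 x.
by rewrite (hom1 (pull_global_hom h)) (hom1 (@smooth_eval_hom R 2 (full _) (h x) I)).
Qed.

End ExpAt.

(** * The points of N as pairs of triangular matrices *)

Section Subgroups.
Variables (R : realType) (A : superAlgType R).

Lemma mx2D (a b c d a' b' c' d' : A) :
  mx2 a b c d + mx2 a' b' c' d' = mx2 (a + a') (b + b') (c + c') (d + d').
Proof. by apply/matrixP => i j; rewrite !mxE; case: ifP => _; case: ifP. Qed.

Lemma mx2N (a b c d : A) : - mx2 a b c d = mx2 (- a) (- b) (- c) (- d).
Proof. by apply/matrixP => i j; rewrite !mxE; case: ifP => _; case: ifP. Qed.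

Lemma mx2_1 : 1%:M = mx2 1 0 0 1 :> 'M[A]_2.
Proof.
by apply/matrixP => i j; rewrite !mxE; case: i j => [[|[|]]] // ? [[|[|]]].
Qed.

Lemma in_N_mx2 (nu mu : A) : is_odd nu -> is_odd mu ->
  in_N (mx2 1 nu 0 1, mx2 1 0 mu 1).
Proof.
move=> on om; exists (mx2 0 nu 0 0, mx2 0 0 mu 0).
rewrite /= mx2_1 !mx2D !addr0 !add0r; split=> //.
have e0 : is_even (0 : A) by exact: parity0.
have o0 : is_odd (0 : A) by rewrite /is_odd parity0 oppr0.
split=> [||a] /=; try by split; rewrite !mxE.
rewrite !mx2N !mx2_mul !mx2N !mx2D !map_mx2 /alpha /= /coordinate scalD scalN.
rewrite !(mulr0, mul0r, addr0, add0r, oppr0, mulNr, mulrN, opprK) !mulrBl.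
by rewrite !(scalC _ nu) !(scalC _ mu) [- _ + _]addrC.
Qed.

(** It suffices to test on h_1, where alpha is 1. Its adjoint action on the upper right and lower
    left entries is by 1 and -1 in the first component and by -1 and 1 in the second; diagonal
    entries have weight 0. *)
Lemma in_NP (n : mxpair A) : in_N n ->
  exists nu mu : A, n = (mx2 1 nu 0 1, mx2 1 0 mu 1).
Proof.
move=> [[x y] [[/= _ _ /(_ (delta_mx 0 0))]]] + ->.
rewrite /= (mx2_eta x) (mx2_eta y) mx2_1 !mx2N !mx2_mul !mx2N !mx2D !map_mx2.
rewrite /alpha /= /coordinate !mxE /= subr0 scal0 scal1.
rewrite !(mulr0, mul0r, addr0, add0r, oppr0, mulNr, mulrN, opprK, mulr1,
  mul1r) !addrN ?addNr.
have z (u : A) : - u = u -> u = 0.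
  by move=> e; apply: Defs.double_inj; rewrite -{1}e addNr addr0.
move=> [/mx2_inj[<- _ /z -> <-] /mx2_inj[<- /z -> _ <-]].
by exists (x 0 1), (y 1 0); rewrite ?addr0 ?add0r.
Qed.

End Subgroups.

(** * The Iwasawa decomposition *)

Section Iwasawa.
Variable R : realType.

Lemma KM_has_value (T : superspace R) (f : global (times_KM T)) (x : T) (c : R[i]) :
  has_value (f.1.1 : global T) x c -> @has_value R (times_KM T) f x c.
Proof.
move=> /has_valueP v; apply/has_valueP => u; apply: v.
have u1 := (odd_line_unit_at (X := odd_line T) _ _).2 u.
exact: ((odd_line_unit_at (X := T) _ _).2 u1).
Qed.

Lemma iwasawa_squares (X : superspace R) (a a' b b' xi eta : global X)
    (H : morphism X (affine_aR R)) :
  is_even a -> is_even a' -> is_even b -> is_even b' ->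
  is_odd xi -> is_odd eta -> a * a' = 1 -> b * b' = 1 ->
  iwasawa (mx2 a (a * xi) (b * eta) b, mx2 a' (a' * xi) (b' * eta) b') H ->
  exp_at (coordinate 1) H * exp_at (coordinate 1) H =
    b * b * (1 - eta * ((1 - a' * a' * (b * b)) * xi)) /\
  exp_at (\- coordinate 0) H * exp_at (\- coordinate 0) H =
    a' * a' * (1 - xi * ((1 - b * b * (a' * a')) * eta)).
Proof.
move=> ea ea' eb eb' ox oe aa' bb' [_ [k [n [[k2 _ _] /in_NP[nu [mu ->]] [e1 e2]]]]].
rewrite /exp_pt /= k2 (mx2_eta k.1) in e1 e2.
apply: iwasawa_unique_squares e1 e2 => //; try exact: exp_at_even; exact: exp_atN.
Qed.

Lemma even_gl_mx2 (A : superAlgType R) (a b c d : A) :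
  is_even a -> is_odd b -> is_odd c -> is_even d -> even_gl (mx2 a b c d).
Proof. by move=> *; split; rewrite !mxE. Qed.

Section Point.
Variables (T : superspace R) (h : morphism T (affine_aR R)).

Let a := exp_at (coordinate 0) h.
Let a' := exp_at (\- coordinate 0) h.
Let b := exp_at (coordinate 1) h.
Let b' := exp_at (\- coordinate 1) h.
Let xi : global (times_KM T) := KM_xi (global T).
Let eta : global (times_KM T) := KM_eta (global T).
Let emb (f : global T) : global (times_KM T) := KM_emb f.

(* e^h (1 xi; eta 1) *)
Definition gk_pt : mxpair (global (times_KM T)) :=
  (mx2 (emb a) (emb a * xi) (emb b * eta) (emb b),
   mx2 (emb a') (emb a' * xi) (emb b' * eta) (emb b')).

Lemma gk_ptE : mxpair_mul (KM_emb_pt (exp_pt h)) (KM_section xi eta) = gk_pt.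
Proof.
rewrite /mxpair_mul /KM_section /KM_emb_pt /exp_pt /= !map_mx2.
have emb0 : KM_emb 0 = 0 :> adjoin (adjoin (global T)) by [].
rewrite !emb0 !mx2_mul.
by rewrite !(mul0r, mulr1, addr0, add0r).
Qed.

(* (1 - e^{-2 alpha(h)}) / 2 *)
Definition iwasawa_coef : global T := scal 2^-1 * (1 - a' * b * (a' * b)).
Let c := 1 - a' * b * (a' * b).

Lemma iwasawa_coef_even : is_even iwasawa_coef.
Proof.
apply: evenM; first exact: parity_scal.
by rewrite /is_even parityD parityN !parityM parity1 !exp_at_even.
Qed.

(** The explicit solution for H(e^h (1 xi; eta 1)). *)
Definition iwasawa_pt : morphism (times_KM T) (affine_aR R) :=
  deform h iwasawa_coef_even.

Lemma exp_at_iwasawa_pt (mu : {scalar 'rV[R[i]]_2}) (k : R[i]) : mu (hplus R) = k ->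
  exp_at mu iwasawa_pt = KM_even (exp_at mu h) (scal k * (iwasawa_coef * exp_at mu h)).
Proof. by move=> <-; exact: exp_at_deform. Qed.

Lemma iwasawa_exp_pt : iwasawa gk_pt iwasawa_pt.
Proof.
have ea : is_even a := exp_at_even _ _; have ea' : is_even a' := exp_at_even _ _.
have eb : is_even b := exp_at_even _ _; have eb' : is_even b' := exp_at_even _ _.
have ee := iwasawa_coef_even; set e := iwasawa_coef in ee *.
have eg : is_even (a' * b) by exact: evenM.
have ec : is_even c by rewrite /is_even parityD parityN !parityM parity1 ea' eb.
have eec : e + e = c.
  have h2 : 2^-1 + 2^-1 = 1 :> R[i] by field.
  by rewrite /e /iwasawa_coef -mulrDl -scalD h2 scal1 mul1r.
have e0 : is_even (0 : global T) by exact: parity0.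
have e1 : is_even (1 : global T) by exact: parity1.
have en : is_even (- e) by rewrite /is_even parityN ee.
have gE := KM_iwasawa ea ea' eb eb' ee (exp_atN _ _) (exp_atN _ _) erefl erefl eec.
split.
  have emb_even (f : global T) : is_even f -> is_even (emb f).
    by move=> ef; exact: (KM_even_even ef e0).
  have emb_xi (f : global T) : is_even f -> is_odd (emb f * xi).
    move=> ef; have := KM_odd_odd ef e0.
    by rewrite -[KM_odd f 0](_ : emb f * xi = _) // /emb /xi KM_xiE KM_embE
      KM_even_odd // mulr1 mulr0.
  have emb_eta (f : global T) : is_even f -> is_odd (emb f * eta).
    move=> ef; have := KM_odd_odd e0 ef.
    by rewrite -[KM_odd 0 f](_ : emb f * eta = _) // /emb /eta KM_etaE KM_embE
      KM_even_odd // mulr1 mulr0.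
  split.
  - apply: even_gl_mx2; solve [exact: emb_even|exact: emb_xi|exact: emb_eta].
  - apply: even_gl_mx2; solve [exact: emb_even|exact: emb_xi|exact: emb_eta].
  move=> x; pose t : 'rV[R]_2 := h x.
  (* The values of the diagonal entries of e^h at x. The first one is real, so its conjugate inverse
     is the exponential of the opposite coordinate. *)
  exists (expR (t 0 0))%:C, (expR (t 0 1)), (expR (- t 0 1)).
  split; first by split; rewrite ?expR_gt0 // fmorph_eq0 gt_eqF ?expR_gt0.
  have tE j : coordinate j (complexify t) = (t 0 j)%:C by rewrite /coordinate mxE.
  have v j : has_value (exp_at (coordinate j) h) x (expR (t 0 j))%:C.
    have := @exp_at_value R T h (coordinate j) x.
    by rewrite /= tE cexp_real.
  have v' j : has_value (exp_at (\- coordinate j) h) x (expR (- t 0 j))%:C.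
    have := @exp_at_value R T h (\- coordinate j) x.
    by rewrite /= tE -rmorphN cexp_real.
  rewrite conjc_real -fmorphV -expRN.
  split; rewrite /gk_pt /= mxE /=; apply: KM_has_value.
  - exact: (v 0).
  - exact: (v 1).
  - exact: (v' 0).
  - exact: (v' 1).
exists (mx2 (KM_even 1 (- e)) (KM_odd (a' * b) 0) (KM_odd 0 (a' * b)) (KM_even 1 e),
  mx2 (KM_even 1 (- e)) (KM_odd (a' * b) 0) (KM_odd 0 (a' * b)) (KM_even 1 e)).
exists (mx2 1 (KM_odd c 0) 0 1, mx2 1 0 (KM_odd 0 c) 1); split.
- split=> //=.
  + apply: even_gl_mx2.
    * exact: (KM_even_even e1 en).
    * exact: (KM_odd_odd eg e0).
    * exact: (KM_odd_odd e0 eg).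
    * exact: (KM_even_even e1 ee).
  (* The diagonal entries of k are 1 up to multiples of xi eta. *)
  move=> x; exists 1, 1; split; rewrite ?normr1 ?mxE //.
    by apply: KM_has_value; exact: (has_value1 h).
  by apply: KM_has_value; exact: (has_value1 h).
- exact: (in_N_mx2 (KM_odd_odd ec e0) (KM_odd_odd e0 ec)).
have Hc j : exp_at (coordinate j) iwasawa_pt =
    KM_even (exp_at (coordinate j) h) (exp_at (coordinate j) h * e).
  rewrite -(even_central _ _ ee) -[X in KM_even _ X]mul1r -(scal1 (s := global T)).
  by apply: exp_at_iwasawa_pt; rewrite /= /coordinate mxE.
have Hn j : exp_at (\- coordinate j) iwasawa_pt =
    KM_even (exp_at (\- coordinate j) h) (- (exp_at (\- coordinate j) h * e)).
  rewrite -(even_central _ _ ee) -[X in KM_even _ X]mulN1r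
    -(scal1 (s := global T)) -scalN.
  by apply: exp_at_iwasawa_pt; rewrite /= /coordinate mxE.
have E : exp_pt iwasawa_pt =
    (mx2 (KM_even a (a * e)) 0 0 (KM_even b (b * e)),
     mx2 (KM_even a' (- (a' * e))) 0 0 (KM_even b' (- (b' * e)))).
  by rewrite /exp_pt !Hc !Hn.
rewrite E; exact: gE.
Qed.

End Point.
End Iwasawa.

(** * The invariant density and the spherical superfunction *)

Lemma K_invariant_const (R : realType) : @K_invariant R ((-1, 0), (0, 0)).
Proof.
move=> S cs k [k2 [ep oq or es] kv] xi' eta' m _ _ [_ m01 m10] E f.
have jS := cs_manifold_jets cs.
(* Both diagonal entries of k have nonzero values everywhere, hence are invertible;
   [berezin_invariance] asks for their inverses. *)
have [p' [pp' _]] : is_unit (k.1 0 0).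
  apply: unit_at_unit => x; have [z [r [z1 r0 vz _]]] := kv x.
  by apply: has_value_unit_at vz => //; rewrite -normr_gt0 z1.
have [s' [ss' _]] : is_unit (k.1 1 1).
  apply: unit_at_unit => x; have [z [r [_ r0 _ vr]]] := kv x.
  by apply: has_value_unit_at vr => //; rewrite fmorph_eq0 gt_eqF.
have := congr1 fst E; rewrite /KM_emb_pt /KM_section /mxpair_mul /=.
rewrite {1}(mx2_eta k.1) (mx2_eta m.1) m01 m10 => E1.
exact: (berezin_invariance ep oq or es pp' ss' E1).
Qed.

Lemma KM_integral_even (R : realType) (A : superAlgType R) (x y : A) :
  KM_integral ((-1, 0), (0, 0)) (KM_even x y) = - y.
Proof.
rewrite /KM_integral /KM_even /= !scal0 !(mul0r, mulr0, addr0, add0r).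
by rewrite scalN scal1 mulN1r.
Qed.

(** Here L, P and N stand for e^{lambda(h)}, e^{alpha(h)} and e^{-alpha(h)}; the point is that (1 -
    N^2) P = P - N. *)
Lemma spherical_identity (R : realType) (A : superAlgType R) (l : R[i]) (L P N : A) :
  is_even L -> is_even P -> is_even N -> P * N = 1 ->
  - (scal l * (scal 2^-1 * (1 - N * N) * (L * P))) =
  scal (- l) * (L * (scal 2^-1 * (P - N))).
Proof.
move=> eL eP eN PN; rewrite scalN mulNr; congr (- (scal l * _)).
rewrite [RHS]mulrA -(scalC _ L) -!mulrA; congr (_ * _).
rewrite mulrA -(even_central _ (1 - N * N) eL) -[LHS]mulrA; congr (_ * _).
by rewrite mulrBl mul1r -mulrA -(even_central _ N eP) PN mulr1.
Qed.

Section Spherical.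
Variables (R : realType) (T : superspace R).
Variable h : morphism T (affine_aR R).
Hypothesis cs : cs_manifold T.

(** [iwasawa_H] chooses some solution; its exponentials are those of the explicit one, since both
    have the squares given by [iwasawa_squares]. *)
Lemma exp_at_iwasawa (H : morphism (times_KM T) (affine_aR R)) mu :
  iwasawa (gk_pt h) H -> exp_at mu H = exp_at mu (iwasawa_pt h).
Proof.
move=> iH; have jK : locally_jets (times_KM T).
  by do 2!apply: odd_line_jets; exact: cs_manifold_jets.
have e0 : is_even (0 : global T) by exact: parity0.
have e1 : is_even (1 : global T) by exact: parity1.
have ev mu' : is_even (KM_emb (exp_at mu' h)).
  exact: (KM_even_even (exp_at_even h mu') e0).
have NE (mu' : {scalar 'rV[R[i]]_2}) :
    KM_emb (exp_at mu' h) * KM_emb (exp_at (\- mu') h) = 1.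
  by rewrite !KM_embE KM_evenM ?exp_atN ?mulr0 ?mul0r ?addr0 //; exact: exp_at_even.
have sq H' := @iwasawa_squares R (times_KM T)
  (KM_emb (exp_at (coordinate 0) h)) (KM_emb (exp_at (\- coordinate 0) h))
  (KM_emb (exp_at (coordinate 1) h)) (KM_emb (exp_at (\- coordinate 1) h))
  (KM_xi _) (KM_eta _) H' (ev _) (ev _) (ev _) (ev _)
  (KM_odd_odd e1 e0) (KM_odd_odd e0 e1) (NE _) (NE _).
have [s1 s0] := sq _ iH; have [t1 t0] := sq _ (iwasawa_exp_pt h).
by apply: exp_at_unique => //; rewrite ?s0 ?s1 ?t0 ?t1.
Qed.

Lemma spherical_exp_pt (lambda : {scalar 'rV[R[i]]_2}) :
  spherical ((-1, 0), (0, 0)) lambda (exp_pt h)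
  = scal (- lambda (hplus R)) * (exp_at lambda h * sinh_at (alpha R) h).
Proof.
rewrite /spherical gk_ptE /iwasawa_H.
case: pselect => [e|[]]; last by exists (iwasawa_pt h); exact: iwasawa_exp_pt.
rewrite (exp_at_iwasawa _ (svalP (cid e))).
(* The form alpha, and with it rho, vanishes on h^+. *)
have l0 : (lambda \- rho R) (hplus R) = lambda (hplus R).
  by rewrite /= /coordinate !mxE subrr oppr0 subr0.
rewrite (exp_at_iwasawa_pt h l0) KM_integral_even.
have -> : exp_at (lambda \- rho R) h = exp_at lambda h * exp_at (alpha R) h.
  by apply: exp_atD => x /=; rewrite opprK.
rewrite /iwasawa_coef /sinh_at.
have <- : exp_at (\- alpha R) h = exp_at (\- coordinate 0) h * exp_at (coordinate 1) h.
  by apply: exp_atD => x /=; rewrite opprB addrC.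
have PN := exp_atN h (alpha R).
move: (exp_at_even h lambda) (exp_at_even h (alpha R)) (exp_at_even h (\- alpha R)) PN.
exact: spherical_identity.
Qed.

End Spherical.

Theorem proposition4p16 (R : realType) :
  exists w : adjoin (adjoin R[i]),
    [/\ w <> 0, K_invariant w &
      forall (lambda : {scalar 'rV[R[i]]_2}) (T : superspace R),
        cs_manifold T ->
      forall h : morphism T (affine_aR R),
        spherical w lambda (exp_pt h)
          = scal (- lambda (hplus R)) * (exp_at lambda h * sinh_at (alpha R) h)].
Proof.
(* The density - D(xi, eta); its sign produces the sign in front of lambda(h^+). *)
exists ((-1, 0), (0, 0)); split.
- by case=> /eqP; rewrite oppr_eq0 oner_eq0.
- exact: K_invariant_const.
- by move=> lambda T cs h; exact: spherical_exp_pt.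
Qed.
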